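(* Let $\Omega^\star\in\mathcal O_E$ be locally optimal for the problem $\min_{\Omega\in\mathcal O_E}\mathcal J(\Omega,y_\Omega)$, i.e. there is $R>0$ such that $\mathcal J(\Omega^\star,y_{\Omega^\star})\le\mathcal J(\Omega,y_\Omega)$ for all $\Omega\in\mathcal O_E$ with $d_{\mathcal H}(\partial\Omega^\star,\partial\Omega)\le R$. Then every $g^\star\in\mathcal F_E$ with $\Omega_{g^\star}=\Omega^\star$ satisfies $$j'(g^\star;h)\ge0$$ for every $h\in\mathcal F$ with $\{h=0\}\cap C\ne\emptyset$ for every connected component $C$ of $\{g^\star=0\}$, provided that $j$ is directionally differentiable at $g^\star$ in direction $h$.
   Context: $D\subset\mathbb R^2$ is a fixed bounded domain and $E\subset\subset D$ is a non-empty subdomain. $p>2$, $f\in L^p(D)$. $\beta:\mathbb R\to\mathbb R$ is monotone increasing, Lipschitz on each interval $[-M,M]$, and directionally differentiable at every point. $\mathcal F:=\{g\in C^2(\bar D): |\nabla g(x)|+|g(x)|>0\ \forall x\in D,\ g(x)>0\ \forall x\in\partial D,\ g^{-1}((-\infty,0])\ne\emptyset\}$; $\Omega_g:=\{x\in D:g(x)<0\}$; $\{g=0\}:=\{x\in D:g(x)=0\}=\partial\Omega_g$ for $g\in\mathcal F$, a finite union of disjoint closed $C^2$ curves without self-intersections (its components). $\mathcal F_E:=\{g\in\mathcal F:g<0\text{ in }\bar E\}$. $\mathcal O:=\{\Omega\subset D:\Omega\text{ is a non-empty }C^2\text{ domain},\ \partial\Omega\cap\partial D=\emptyset\}$ and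 $\mathcal O_E:=\{\Omega\in\mathcal O:E\subset\subset\Omega\}$. For a subset $\Omega$ of $D$ of class $C^2$, $y_\Omega\in H^1_0(\Omega)$ is the solution of $-\Delta y_\Omega+\beta(y_\Omega)=f$ in $\Omega$, $y_\Omega=0$ on $\partial\Omega$, extended by zero to $D$; $y_g:=y_{\Omega_g}$. $\mathcal J:\mathcal C_2\times H_0^1(D)\to\mathbb R$ is a given functional, where $\mathcal C_2$ is the set of all subsets of $D$ of class $C^2$, and $j(g):=\mathcal J(\Omega_g,y_g)$. $d_{\mathcal H}$ is the Hausdorff–Pompeiu distance between compact sets. For $g\in\mathcal F_E$ and $h\in C^2(\bar D)$ one has $g+\lambda h\in\mathcal F_E$ for small $\lambda>0$; $j$ is directionally differentiable at $g$ in direction $h$ if $j'(g;h):=\lim_{\lambda\searrow0}(j(g+\lambda h)-j(g))/\lambda$ exists in $\mathbb R$. *)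

(* Defs.v *)
From HB Require Import structures.
From mathcomp Require Import all_boot all_order all_algebra.
From mathcomp Require Import all_classical all_reals all_analysis.
Set Implicit Arguments.
Unset Strict Implicit.
Unset Printing Implicit Defensive.
Import Order.TTheory GRing.Theory Num.Theory.
Import numFieldNormedType.Exports.
Local Open Scope classical_set_scope.
Local Open Scope ring_scope.

Section plane.
Context {R : realType}.

(* The normed-module structure of R * R carries the max norm.  It is only used
   for the topology, boundedness and derivatives; metric notions such as balls
   and the Hausdorff distance use the Euclidean norm below. *)
Local Notation plane := (R * R)%type.

Definition enorm (x : plane) : R := Num.sqrt (x.1 ^+ 2 + x.2 ^+ 2).
Definition edist (x y : plane) : R := enorm (x - y).

Definition bd (A : set plane) : set plane := closure A `\` A°.

Definition domain (A : set plane) : Prop :=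
  [/\ A !=set0, open A & connected A].

Definition compactly_contained (A B : set plane) : Prop :=
  compact (closure A) /\ closure A `<=` B.

Definition hausdorff_dist (A B : set plane) : R :=
  Num.max (sup [set inf [set edist a b | b in B] | a in A])
          (sup [set inf [set edist a b | a in A] | b in B]).

Definition components (A : set plane) : set (set plane) :=
  [set connected_component A x | x in A].

Definition e1 : plane := (1, 0).
Definition e2 : plane := (0, 1).

Definition grad (g : plane -> R) (x : plane) : plane :=
  ('D_e1 g x, 'D_e2 g x).

(* g is of class C^k in the open set A, and all its partial derivatives of order
   at most k (including g) extend continuously from A to the closure of A.
   The values of g outside A play no role. *)
Fixpoint Ck_ext (k : nat) (A : set plane) (g : plane -> R) : Prop :=
  (exists2 v : plane -> R, {within closure A, continuous v}
     & forall x, A x -> v x = g x) /\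
  (if k is k'.+1 then
     [/\ forall x, A x -> derivable g x e1 /\ derivable g x e2,
         Ck_ext k' A ('D_e1 g)
       & Ck_ext k' A ('D_e2 g)]
   else True).

(* C^2 functions on the closure of D, given by arbitrary representatives on the
   whole plane: continuity up to the boundary ties the values of g on bd D to
   those on D. *)
Definition C2_closure (D : set plane) (g : plane -> R) : Prop :=
  {within closure D, continuous g} /\ Ck_ext 2 D g.

Definition C2_line (gam : R -> R) : Prop :=
  [/\ forall t, derivable gam t 1,
      forall t, derivable (derive1 gam) t 1
    & continuous (derive1 (derive1 gam))].

(* Near each boundary point, in suitable orthonormal coordinates, the open set
   Om is the strict epigraph of a C^2 function; n is the unit vector of the
   vertical axis and (- n.2, n.1) that of the horizontal one. *)
Definition C2_set (Om : set plane) : Prop :=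
  open Om /\
  forall x0, bd Om x0 ->
    exists r n (gam : R -> R), [/\ 0 < r, enorm n = 1, C2_line gam &
      forall x, edist x x0 < r ->
        (Om x <-> gam (n.1 * x.2 - n.2 * x.1) < n.1 * x.1 + n.2 * x.2)].

Definition C2_subsets (D : set plane) : set (set plane) :=
  [set Om | Om `<=` D /\ C2_set Om].

Definition shapes (D : set plane) : set (set plane) :=
  [set Om | [/\ Om `<=` D, domain Om, C2_set Om & bd Om `&` bd D = set0]].

Definition shapesE (D E : set plane) : set (set plane) :=
  [set Om | shapes D Om /\ compactly_contained E Om].

Definition sublevel (D : set plane) (g : plane -> R) : set plane :=
  [set x | D x /\ g x < 0].

Definition zeroset (D : set plane) (g : plane -> R) : set plane :=
  [set x | D x /\ g x = 0].

Definition levelsets (D : set plane) : set (plane -> R) :=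
  [set g | [/\ C2_closure D g,
     forall x, D x -> 0 < enorm (grad g x) + `|g x|,
     forall x, bd D x -> 0 < g x
   & exists2 x, closure D x & g x <= 0]].

Definition levelsetsE (D E : set plane) : set (plane -> R) :=
  [set g | levelsets D g /\ forall x, closure E x -> g x < 0].

Definition lebesgue2 :
    {measure set (measurableTypeR R * measurableTypeR R) -> \bar R} :=
  (@lebesgue_measure R \x @lebesgue_measure R)%E.

(* Functions on Om are represented by functions on the plane, whose restriction
   extended by zero is u \_ Om. *)
Definition memLp (Om : set plane) (p : R) (u : plane -> R) : Prop :=
  (u \_ Om : _ -> R) \in Lfun lebesgue2 p%:E.

Definition normLp (Om : set plane) (p : R) (u : plane -> R) : \bar R :=
  ('N[lebesgue2]_(p%:E) [EFin \o (u \_ Om)])%E.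

Definition test_fun (Om : set plane) (phi : plane -> R) : Prop :=
  (forall k, Ck_ext k setT phi) /\
  compactly_contained [set x | phi x != 0] Om.

Definition weak_partial (Om : set plane) (e : plane) (u w : plane -> R) : Prop :=
  forall phi, test_fun Om phi ->
    \int[lebesgue2]_(x in Om) (u x * 'D_e phi x) =
    - \int[lebesgue2]_(x in Om) (w x * phi x).

(* u is in H^1_0(Om), the H^1-closure of the test functions, and w1, w2 are its
   weak partial derivatives. *)
Definition H10_grad (Om : set plane) (u w1 w2 : plane -> R) : Prop :=
  [/\ [/\ memLp Om 2 u, memLp Om 2 w1 & memLp Om 2 w2],
      weak_partial Om e1 u w1, weak_partial Om e2 u w2
    & exists phi : nat -> plane -> R, [/\ forall n, test_fun Om (phi n),
        normLp Om 2 (u \- phi n) @[n --> \oo] --> 0%E,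
        normLp Om 2 (w1 \- 'D_e1 (phi n)) @[n --> \oo] --> 0%E
      & normLp Om 2 (w2 \- 'D_e2 (phi n)) @[n --> \oo] --> 0%E]].

Definition H10 (Om : set plane) : set (plane -> R) :=
  [set u | exists w1 w2, H10_grad Om u w1 w2].

(* Weak formulation of - Delta y + beta(y) = f in Om, y = 0 on bd Om.  As beta is
   only locally Lipschitz, the integrability of beta(y) * phi is part of the
   notion of solution.  The first clause is the extension by zero. *)
Definition is_state (beta : R -> R) (f : plane -> R) (Om : set plane)
    (y : plane -> R) : Prop :=
  (forall x, ~ Om x -> y x = 0) /\
  exists w1 w2, H10_grad Om y w1 w2 /\
    forall phi, test_fun Om phi ->
      lebesgue2.-integrable Om (EFin \o (fun x => beta (y x) * phi x)) /\
      \int[lebesgue2]_(x in Om) (w1 x * 'D_e1 phi x + w2 x * 'D_e2 phi x)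
        + \int[lebesgue2]_(x in Om) (beta (y x) * phi x)
      = \int[lebesgue2]_(x in Om) (f x * phi x).

(* The solution y_Om (it exists, and is unique up to a null set, under the
   assumptions on beta and f). *)
Definition state (beta : R -> R) (f : plane -> R) (Om : set plane) : plane -> R :=
  xget (cst 0) [set y | is_state beta f Om y].

(* The functional J is defined on C_2 x H^1_0(D), i.e. on classes of functions
   modulo equality almost everywhere in D. *)
Definition respects_ae (D : set plane)
    (J : set plane -> (plane -> R) -> R) : Prop :=
  forall Om y1 y2, C2_subsets D Om -> H10 D y1 -> H10 D y2 ->
    {ae lebesgue2, forall x, D x -> y1 x = y2 x} -> J Om y1 = J Om y2.

Definition reduced (D : set plane) (beta : R -> R) (f : plane -> R)
    (J : set plane -> (plane -> R) -> R) (g : plane -> R) : R :=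
  J (sublevel D g) (state beta f (sublevel D g)).

Definition locally_optimal (D E : set plane) (beta : R -> R) (f : plane -> R)
    (J : set plane -> (plane -> R) -> R) (Oms : set plane) : Prop :=
  shapesE D E Oms /\
  exists2 r : R, 0 < r & forall Om, shapesE D E Om ->
    hausdorff_dist (bd Oms) (bd Om) <= r ->
    J Oms (state beta f Oms) <= J Om (state beta f Om).

End plane.

Section dirdiff.
Context {R : realType} {V : lmodType R}.

Definition diffquot (j : V -> R) (g h : V) (lam : R) : R :=
  (j (g + lam *: h) - j g) / lam.

Definition dir_differentiable (j : V -> R) (g h : V) : Prop :=
  cvg (diffquot j g h lam @[lam --> 0^'+]).

Definition dir_deriv (j : V -> R) (g h : V) : R :=
  lim (diffquot j g h lam @[lam --> 0^'+]).

End dirdiff.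

Definition admissible_nonlinearity {R : realType} (beta : R -> R) : Prop :=
  [/\ {homo beta : s t / s <= t},
      forall M : R, [lipschitz beta t | t in [set` `[- M, M]]]
    & forall t s : R^o, dir_differentiable beta t s].

(* Main.v *)
From HB Require Import structures.
Require Import Defs.
From mathcomp Require Import all_boot all_order all_algebra.
From mathcomp Require Import all_classical all_reals all_analysis.
From mathcomp Require Import ring lra.
Import Order.TTheory GRing.Theory Num.Theory.
Import numFieldNormedType.Exports.
Local Open Scope classical_set_scope.
Local Open Scope ring_scope.

(** Write G_l for g + l h and S_l for the sublevel set where G_l is negative.
    For all small l > 0, S_l is an admissible shape and its boundary is as close
    to that of S_0 as one likes ([perturb_shapes]).  Local optimality of S_0 then
    makes all difference quotients with small l nonnegative, hence their limit.

    All properties of S_l follow one scheme: if a property of (l, x) holds for x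
    near each point y of the compact set closure D and for l near 0, then for l
    near 0 it holds at all points of closure D ([near_closure]).  Since g is
    positive on bd D, there are three kinds of points y.  If g y > 0 or g y < 0,
    then the sign of G_l is the same near y.  If g y = 0, then y is in D,
    grad g y <> 0, and on a fixed neighbourhood of y the functions g and G_l
    strictly decrease along d = - grad g y ([regular_decreasing]).

    - Every zero of G_l is close to a zero of g, as G_l <> 0 elsewhere.
      Conversely, near a zero y of g, G_l changes sign on a short segment
      through y with direction d.  As the boundary of a regular sublevel set is
      its zero set ([bd_sublevel]), this bounds the Hausdorff distance.
    - A point of S_l close to a zero y of g can be moved along d, without leaving
      S_l, until it is close to a point z with g z < 0.  Any such z is joined
      inside S_l to a base point of S_0 for small l, because S_0 is connected
      ([perturb_component]).  Hence S_l is connected.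
    - The gradient of G_l does not vanish on the zeros of G_l, so S_l is of class
      C^2 by the implicit function theorem ([sublevel_graph]).

    For the implicit function theorem, rotate the coordinates so that the
    vertical axis points along - grad.  On a small box the horizontal derivative
    is then smaller in absolute value than the vertical one, and u strictly
    decreases along every increment that is at least as vertical as horizontal.
    This cone condition gives existence, uniqueness and Lipschitz continuity of
    the function whose graph is the zero set; the mean value theorem gives its
    derivative.  The graph function lives on an interval; composing it with a
    bounded C^2 function that is the identity near the centre extends it to the
    line ([C2_line_extension]). *)

(** * Euclidean and maximum norms, lines in the plane *)

Section norms.
Context {R : realType}.
Implicit Types x v : R * R.

Lemma enorm_ge0 x : 0 <= enorm x. Proof. exact: sqrtr_ge0. Qed.

Lemma sqr_enorm x : enorm x ^+ 2 = x.1 ^+ 2 + x.2 ^+ 2.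
Proof. by rewrite sqr_sqrtr// addr_ge0// sqr_ge0. Qed.

Lemma enorm_gt0 x : (0 < enorm x) = (0 < x.1 ^+ 2 + x.2 ^+ 2).
Proof. by rewrite sqrtr_gt0. Qed.

Lemma coord1_le_enorm x : `|x.1| <= enorm x.
Proof. by rewrite -sqrtr_sqr ler_wsqrtr// lerDl sqr_ge0. Qed.

Lemma coord2_le_enorm x : `|x.2| <= enorm x.
Proof. by rewrite -sqrtr_sqr ler_wsqrtr// lerDr sqr_ge0. Qed.

(** Not sharp (the best constant is the square root of 2). *)
Lemma enorm_le_norm x : enorm x <= 2 * `|x|.
Proof.
rewrite -[leRHS]ger0_norm ?mulr_ge0// -sqrtr_sqr ler_wsqrtr//.
rewrite -(real_normK (num_real x.1)) -(real_normK (num_real x.2)) prod_normE.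
have := normr_ge0 x.1; have := normr_ge0 x.2.
by rewrite /Num.max; case: ifPn; rewrite -?leNgt; nra.
Qed.

End norms.

Section lines.
Context {R : realType}.
Implicit Types (u : R * R -> R) (x v : R * R).

Lemma is_derive_line u x v (t : R) : derivable u (x + t *: v) v ->
  is_derive t 1 (fun s => u (x + s *: v)) ('D_v u (x + t *: v)).
Proof.
have E : (fun h : R => h^-1 *: (((fun s => u (x + s *: v)) \o shift t) (h *: 1)
      - u (x + t *: v))) =
    (fun h : R => h^-1 *: ((u \o shift (x + t *: v)) (h *: v) - u (x + t *: v))).
  apply/funext => h /=; congr (_ *: (u _ - _)).
  by rewrite scalerDl scaler1 addrCA.
by move=> du; apply: DeriveDef; rewrite /derivable /derive E.
Qed.

(** The direction v is kept apart from the signed length s, so that the lemma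
    only asks for derivatives along v itself. *)
Lemma MVT_line u x v (s : R) :
    (forall r, r \in `[0 : R, 1] -> derivable u (x + (s * r) *: v) v) ->
  exists2 r, r \in `[0 : R, 1] &
    u (x + s *: v) - u x = s * 'D_v u (x + (s * r) *: v).
Proof.
move=> du.
have dphi t : t \in `[0 : R, 1] ->
    is_derive t 1 (fun r => u (x + (s * r) *: v)) (s * 'D_v u (x + (s * t) *: v)).
  move=> /du/is_derive_line H; rewrite mulrC.
  apply: (@is_derive1_comp _ (fun r => u (x + r *: v)) (fun r => s * r) t).
  have := @is_deriveM _ _ (cst s) id t 1 0 1 (is_derive_cst _ _ _) (is_derive_id _ _).
  by move=> Hd; apply: is_derive_eq Hd _; rewrite scaler0 addr0 scaler1.
have cphi : {within `[0, 1], continuous (fun r => u (x + (s * r) *: v))}.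
  by apply: derivable_within_continuous => t /dphi[].
have dphio t : t \in `]0 : R, 1[ ->
    is_derive t 1 (fun r => u (x + (s * r) *: v)) (s * 'D_v u (x + (s * t) *: v)).
  by move=> /subset_itv_oo_cc; exact: dphi.
have [t tI] := MVT_segment ler01 dphio cphi.
by rewrite mulr1 mulr0 scale0r addr0 subr0 mulr1 => ->; exists t.
Qed.

Lemma segment_connected x v (s : R) :
  connected ((fun t : R => x + t *: v) @` `[0, s]).
Proof.
apply: connected_continuous_connected.
  exact/connected_intervalP/interval_is_interval.
apply: continuous_subspaceT => t.
by apply: cvgD; [exact: cvg_cst|apply: cvgZr_tmp; exact: cvg_id].
Qed.

End lines.

(** * Extending C^2 functions from an interval to the line *)

Section extension.
Context {R : realType}.
Implicit Types (F dF : R -> R).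

Definition pos_part (s : R) : R := Num.max s 0.

Lemma continuous_pos_part : continuous pos_part.
Proof.
by move=> s; apply: (@continuous_max _ _ id (cst 0)); [exact: cvg_id|exact: cvg_cst].
Qed.

Lemma cvg_is_derive (f : R -> R) (t df : R) :
  (fun h => h^-1 *: ((f \o shift t) (h *: 1) - f t)) @ 0^' --> df ->
  is_derive t 1 f df.
Proof.
by move=> H; apply: DeriveDef; [apply/cvg_ex; exists df|exact: cvg_lim H].
Qed.

(** Replacing a function by a constant to the left of 0 keeps it differentiable
    when its derivative vanishes at 0. *)
Lemma is_derive_pos_part F dF (s : R) : (forall t : R, is_derive t 1 F (dF t)) -> dF 0 = 0 ->
  is_derive s 1 (F \o pos_part) (dF (pos_part s)).
Proof.
move=> FdF dF0; have [s0|s0|->] := ltgtP s 0.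
- have -> : dF (pos_part s) = 0 by rewrite /pos_part max_r ?(ltW s0).
  apply: (@near_eq_is_derive _ _ _ (cst (F 0))).
  near=> t; rewrite /= /pos_part max_r//; apply: ltW; near: t.
  exact: lt_nbhsl.
- have -> : pos_part s = s by rewrite /pos_part max_l// ltW.
  apply: near_eq_is_derive (FdF s).
  near=> t; rewrite /= /pos_part max_l//; apply: ltW; near: t.
  exact: lt_nbhsr.
- have -> : dF (pos_part 0) = 0 by rewrite /pos_part maxxx.
  have [dd dv] := FdF 0; rewrite dF0 in dv.
  apply: cvg_is_derive; apply/cvgrPdist_lt => e e0.
  have : (fun h => h^-1 *: ((F \o shift 0) (h *: 1) - F 0)) @ 0^' --> 'D_1 F 0.
    exact: dd.
  rewrite dv.
  move/cvgrPdist_lt => /(_ _ e0); apply: filterS => h.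
  rewrite !sub0r !normrN /= !scaler1 !addr0 /pos_part maxxx.
  by have [h0|h0] := leP h 0 => //; rewrite subrr scaler0 normr0.
Unshelve. all: by end_near. Qed.

Lemma C2_lineI (f df ddf : R -> R) : (forall t : R, is_derive t 1 f (df t)) ->
  (forall t : R, is_derive t 1 df (ddf t)) -> continuous ddf -> C2_line f.
Proof.
move=> fdf dfddf cddf.
have E1 : derive1 f = df by apply/funext => t; rewrite derive1E; have [] := fdf t.
have E2 : derive1 df = ddf.
  by apply/funext => t; rewrite derive1E; have [] := dfddf t.
by split; rewrite ?E1 ?E2//.
Qed.

(** The function t - F (t - 1) + F (- t - 1), where F s = s - sin s for s >= 0
    and F s = 0 for s <= 0.  As s - sin s vanishes to second order at 0, this is
    of class C^2; it is the identity on [-1, 1] and t -> 1 + sin (t - 1) on the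
    right of 1, hence bounded. *)
Definition clip (t : R) : R :=
  t - (pos_part (t - 1) - sin (pos_part (t - 1))) + (pos_part (- t - 1) - sin (pos_part (- t - 1))).

Definition dclip (t : R) : R :=
  1 - (1 - cos (pos_part (t - 1))) - (1 - cos (pos_part (- t - 1))).

Definition ddclip (t : R) : R := sin (pos_part (- t - 1)) - sin (pos_part (t - 1)).

Lemma is_derive_subr1 (t : R) : is_derive t 1 (fun s : R => s - 1) 1.
Proof.
have := @is_deriveB R R R id (cst 1) t 1 1 0 (is_derive_id _ _) (is_derive_cst _ _ _).
by rewrite subr0.
Qed.

Lemma is_derive_oppr_sub1 (t : R) : is_derive t 1 (fun s : R => - s - 1) (- 1).
Proof.
have := @is_deriveB R R R (- id) (cst 1) t 1 (- 1) 0
  (@is_deriveN R R R id t 1 1 (is_derive_id _ _)) (is_derive_cst _ _ _).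
by rewrite subr0.
Qed.

Lemma is_derive_sub_sin (t : R) :
  is_derive t 1 (fun s : R => s - sin s) (1 - cos t).
Proof. exact: (@is_deriveB R R R id sin). Qed.

Lemma is_derive_onem_cos (t : R) :
  is_derive t 1 (fun s : R => 1 - cos s) (sin t).
Proof.
by have := @is_deriveB R R R (cst 1) cos t 1 0 _ (is_derive_cst _ _ _) (is_derive_cos t);
  rewrite sub0r opprK.
Qed.

Lemma is_derive_clip (t : R) : is_derive t 1 clip (dclip t).
Proof.
have F0 : 1 - cos 0 = 0 :> R by rewrite cos0 subrr.
have P s := is_derive_pos_part _ _ s is_derive_sub_sin F0.
have D1 := @is_derive1_comp _ _ (fun s : R => s - 1) t _ _ (P _) (is_derive_subr1 t).
have D2 := @is_derive1_comp _ _ (fun s : R => - s - 1) t _ _ (P _)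
  (is_derive_oppr_sub1 t).
have D3 := @is_deriveB R R R id _ t 1 _ _ (is_derive_id _ _) D1.
have := @is_deriveD R R R _ _ t 1 _ _ D3 D2.
by rewrite mulr1 mulrN1.
Qed.

Lemma is_derive_dclip (t : R) : is_derive t 1 dclip (ddclip t).
Proof.
have P s := is_derive_pos_part _ _ s is_derive_onem_cos (@sin0 R).
have D1 := @is_derive1_comp _ _ (fun s : R => s - 1) t _ _ (P _) (is_derive_subr1 t).
have D2 := @is_derive1_comp _ _ (fun s : R => - s - 1) t _ _ (P _)
  (is_derive_oppr_sub1 t).
have D3 := @is_deriveB R R R (cst 1) _ t 1 _ _ (is_derive_cst _ _ _) D1.
have := @is_deriveB R R R _ _ t 1 _ _ D3 D2.
by rewrite mulr1 mulrN1 sub0r opprK [X in is_derive _ _ _ X]addrC.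
Qed.

Lemma ddclip_continuous : continuous ddclip.
Proof.
have H : continuous (fun s => sin (pos_part s)).
  move=> s; apply: continuous_comp; first exact: continuous_pos_part.
  exact: continuous_sin.
have c1 : continuous (fun s : R => s - 1).
  by move=> t; have [/derivable1_diffP/differentiable_continuous] := is_derive_subr1 t.
have c2 : continuous (fun s : R => - s - 1).
  move=> t.
  by have [/derivable1_diffP/differentiable_continuous] := is_derive_oppr_sub1 t.
move=> t; apply: cvgB.
  exact: (continuous_comp (c2 t) (H _)).
exact: (continuous_comp (c1 t) (H _)).
Qed.

Lemma clip_id (t : R) : `|t| <= 1 -> clip t = t.
Proof.
rewrite ler_norml => /andP[t1 t2]; rewrite /clip /pos_part !max_r ?sin0; lra.
Qed.

Lemma clip_le2 (t : R) : `|clip t| <= 2.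
Proof.
have [t1|t1] := leP `|t| 1; first by rewrite clip_id//; lra.
have S (s : R) : `|sin s| <= 1 by rewrite ler_norml sin_geN1 sin_le1.
have [t0|t0] := leP 0 t.
  rewrite ger0_norm// in t1; rewrite /clip /pos_part max_l ?max_r ?sin0; [|lra|lra].
  have := S (t - 1); rewrite !ler_norml => /andP[s1 s2]; apply/andP; split; lra.
rewrite ltr0_norm// in t1; rewrite /clip /pos_part max_r ?max_l ?sin0; [|lra|lra].
have := S (- t - 1); rewrite !ler_norml => /andP[s1 s2]; apply/andP; split; lra.
Qed.

(** The extension is f composed with a rescaled copy of [clip] centred at t0,
    which takes its values in the interval where f is given. *)
Lemma C2_line_extension (f df ddf : R -> R) (t0 e : R) : 0 < e ->
    (forall t, `|t - t0| < e -> is_derive t 1 f (df t)) ->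
    (forall t, `|t - t0| < e -> is_derive t 1 df (ddf t)) ->
    (forall t, `|t - t0| < e -> {for t, continuous ddf}) ->
  exists2 gam, C2_line gam & forall t, `|t - t0| <= e / 4 -> gam t = f t.
Proof.
move=> e0 fdf dfddf cddf.
(* k is such that the values of t0 + k * clip stay within e / 2 of t0. *)
pose k := e / 4; have k0 : 0 < k by rewrite divr_gt0.
pose a (t : R) : R := (t - t0) / k.
have ka t : k * a t = t - t0 by rewrite /a mulrC divfK// gt_eqF.
have da (t : R) : is_derive t 1 a k^-1.
  have H1 := @is_deriveB R R R id (cst t0) t 1 1 0 (is_derive_id _ _) (is_derive_cst _ _ _).
  have := @is_deriveM R R _ (cst k^-1) t 1 _ _ H1 (is_derive_cst _ _ _).
  by rewrite scaler0 subr0 add0r /GRing.scale/= mulr1.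
pose th t := t0 + k * clip (a t); pose dth t := dclip (a t).
pose ddth t := ddclip (a t) / k.
have thI t : `|th t - t0| < e.
  rewrite /th addrAC subrr add0r normrM gtr0_norm//.
  have := ler_wpM2l (ltW k0) (clip_le2 (a t)); rewrite /k.
  by move=> /le_lt_trans; apply; lra.
have dthE (t : R) : is_derive t 1 th (dth t).
  have H1 := @is_derive1_comp _ clip a t _ _ (is_derive_clip _) (da t).
  have H2 := @is_deriveM R R (cst k) _ t 1 _ _ (is_derive_cst _ _ _) H1.
  have := @is_deriveD R R R (cst t0) _ t 1 _ _ (is_derive_cst _ _ _) H2.
  rewrite add0r scaler0 addr0 /GRing.scale/= mulrCA mulfV ?gt_eqF// mulr1.
  exact.
have ddthE (t : R) : is_derive t 1 dth (ddth t).
  exact: (@is_derive1_comp _ dclip a t _ _ (is_derive_dclip _) (da t)).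
have cth : continuous th.
  by move=> t; have [/derivable1_diffP/differentiable_continuous] := dthE t.
have cdth : continuous dth.
  by move=> t; have [/derivable1_diffP/differentiable_continuous] := ddthE t.
have ca : continuous a.
  by move=> t; have [/derivable1_diffP/differentiable_continuous] := da t.
have cddth : continuous ddth.
  move=> t; apply: cvgM; last exact: cvg_cst.
  by apply: continuous_comp; [exact: ca|exact: ddclip_continuous].
exists (f \o th).
  apply: (C2_lineI _ (fun t => df (th t) * dth t)
    (fun t => df (th t) * ddth t + dth t * (ddf (th t) * dth t))).
  - by move=> t; exact: (is_derive1_comp (fdf _ (thI t)) (dthE t)).
  - move=> t; have H1 := is_derive1_comp (dfddf _ (thI t)) (dthE t).
    exact: (@is_deriveM R R _ _ t 1 _ _ H1 (ddthE t)).
  - move=> t.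
    have c1 : {for t, continuous (df \o th)}.
      apply: continuous_comp; first exact: cth.
      by have [/derivable1_diffP/differentiable_continuous] := dfddf _ (thI t).
    have c2 : {for t, continuous (ddf \o th)}.
      by apply: continuous_comp; [exact: cth|exact: cddf].
    apply: cvgD; first by apply: cvgM; [exact: c1|exact: cddth].
    apply: cvgM; first exact: cdth.
    by apply: cvgM; [exact: c2|exact: cdth].
move=> t te; rewrite /= /th clip_id ?ka; first by congr f; lra.
by rewrite /a normrM normfV (gtr0_norm k0) ler_pdivrMr// mul1r.
Qed.

End extension.

(** * Functions of class C^1 and C^2 on open subsets of the plane *)

Section C1.
Context {R : realType}.
Implicit Types (A : set (R * R)) (u : R * R -> R) (x v : R * R).

Definition C1_along (e : R * R) A u := forall x, A x ->
  derivable u x e /\ {for x, continuous ('D_e u)}.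

Definition C1_on A u := C1_along e1 A u /\ C1_along e2 A u.

Lemma plane_decomp x v : x + v = (x + v.1 *: e1) + v.2 *: e2.
Proof.
case: x v => [a b] [c d]; rewrite /e1 /e2.
by congr (_, _); rewrite /= ?scaler0 ?scaler1 ?addr0.
Qed.

Lemma near_ball_box (P : set (R * R)) x : (\forall y \near x, P y) ->
  exists2 r : R, 0 < r & forall y, `|y.1 - x.1| < r -> `|y.2 - x.2| < r -> P y.
Proof.
move=> /nbhs_ballP[r r0 rP]; exists r => // y y1 y2.
by apply: rP; split => /=; rewrite /ball/= distrC.
Qed.

(** The differential of a function with partial derivatives a and b. *)
Definition dlin (a b : R) (v : R * R) : R := v.1 * a + v.2 * b.

Lemma dlin_is_linear a b : linear (dlin a b).
Proof. by move=> k v w; rewrite /dlin /= /GRing.scale/=; ring. Qed.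

HB.instance Definition _ a b :=
  GRing.isLinear.Build R (R * R)%type R _ (dlin a b) (dlin_is_linear a b).

Lemma dlin_continuous a b : continuous (dlin a b).
Proof.
move=> v; apply: cvgD; apply: cvgM; try exact: cvg_cst.
  exact: cvg_fst.
exact: cvg_snd.
Qed.

(* From here on e1 and e2 are just two directions. *)
#[local] Opaque derive e1 e2.

Lemma lin_estimate (h1 h2 a b N e : R) : `|h1| <= N -> `|h2| <= N ->
  `|a| < e / 2 -> `|b| < e / 2 -> `|h1 * a + h2 * b| <= e * N.
Proof.
move=> l1 l2 d1 d2; apply: (le_trans (ler_normD _ _)); rewrite !normrM.
have := ler_pM (normr_ge0 _) (normr_ge0 _) l1 (ltW d1).
have := ler_pM (normr_ge0 _) (normr_ge0 _) l2 (ltW d2).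
by lra.
Qed.

(** An increment is split into a horizontal and a vertical one, and the mean
    value theorem is applied to each of them. *)
Lemma C1_diff A u x : open A -> C1_on A u -> A x ->
  is_diff x u (dlin ('D_e1 u x) ('D_e2 u x)).
Proof.
move=> oA [uA1 uA2] Ax.
have H : u \o shift x = cst (u x) + dlin ('D_e1 u x) ('D_e2 u x) +o_ (0 : R * R) id.
  apply/eqaddoP => _/posnumP[e].
  have e20 : 0 < e%:num / 2 by [].
  have [_ c1] := uA1 _ Ax; have [_ c2] := uA2 _ Ax.
  have nA : \forall y \near x, A y by exact: open_nbhs_nbhs.
  have n1 : \forall y \near x, `|'D_e1 u x - 'D_e1 u y| < e%:num / 2.
    by move/cvgrPdist_lt/(_ _ e20) : c1.
  have n2 : \forall y \near x, `|'D_e2 u x - 'D_e2 u y| < e%:num / 2.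
    by move/cvgrPdist_lt/(_ _ e20) : c2.
  have : \forall y \near x, [/\ A y, `|'D_e1 u x - 'D_e1 u y| < e%:num / 2 &
      `|'D_e2 u x - 'D_e2 u y| < e%:num / 2].
    by apply: filterS3 nA n1 n2 => y ? ? ?; split.
  move=> /near_ball_box[r r0 rP].
  have : \forall h \near (0 : R * R), `|h| < r.
    by apply/nbhs_ballP; exists r => //= h; rewrite -ball_normE /ball_/= sub0r normrN.
  apply: filterS => h hr.
  have := hr; rewrite {1}prod_normE gt_max => /andP[h1 h2].
  have x1 : forall t : R, `|t| <= `|h.1| -> [/\ A (x + t *: e1),
      `|'D_e1 u x - 'D_e1 u (x + t *: e1)| < e%:num / 2 &
      `|'D_e2 u x - 'D_e2 u (x + t *: e1)| < e%:num / 2].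
    move=> t th; apply: rP => /=.
      by rewrite scaler1 addrAC subrr add0r (le_lt_trans th).
    by rewrite scaler0 addr0 subrr normr0.
  have x2 : forall t : R, `|t| <= `|h.2| -> [/\ A ((x + h.1 *: e1) + t *: e2),
      `|'D_e1 u x - 'D_e1 u ((x + h.1 *: e1) + t *: e2)| < e%:num / 2 &
      `|'D_e2 u x - 'D_e2 u ((x + h.1 *: e1) + t *: e2)| < e%:num / 2].
    move=> t th; apply: rP => /=.
      by rewrite scaler1 scaler0 addr0 addrAC subrr add0r.
    by rewrite scaler1 scaler0 addr0 addrAC subrr add0r (le_lt_trans th).
  have small (k l : R) : l \in `[0 : R, 1] -> `|k * l| <= `|k|.
    by rewrite in_itv/= normrM => /andP[? ?]; rewrite ler_piMr// ger0_norm.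
  have [|r1 r1I E1] := @MVT_line R u x e1 h.1.
    by move=> t /small/x1[/uA1[]].
  have [|r2 r2I E2] := @MVT_line R u (x + h.1 *: e1) e2 h.2.
    by move=> t /small/x2[/uA2[]].
  have [_ d1 _] := x1 _ (small _ _ r1I); have [_ _ d2] := x2 _ (small _ _ r2I).
  move: d1 d2 E1 E2; set t1 := h.1 * r1; set t2 := h.2 * r2 => d1 d2 E1 E2.
  have -> : (u \o shift x - (cst (u x) + dlin ('D_e1 u x) ('D_e2 u x))) h =
     h.1 * ('D_e1 u (x + t1 *: e1) - 'D_e1 u x) +
     h.2 * ('D_e2 u (x + h.1 *: e1 + t2 *: e2) - 'D_e2 u x).
    change (u (h + x) - (u x + (h.1 * 'D_e1 u x + h.2 * 'D_e2 u x)) =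
      h.1 * ('D_e1 u (x + t1 *: e1) - 'D_e1 u x) +
      h.2 * ('D_e2 u (x + h.1 *: e1 + t2 *: e2) - 'D_e2 u x)).
    rewrite (addrC h) (plane_decomp x h).
    move/eqP: E1; rewrite subr_eq => /eqP E1.
    move/eqP: E2; rewrite subr_eq => /eqP ->.
    by rewrite E1; ring.
  move: d1 d2; rewrite (distrC ('D_e1 u x)) (distrC ('D_e2 u x)) => d1 d2.
  have /andP[l1 l2] : (`|h.1| <= `|h|) && (`|h.2| <= `|h|).
    by rewrite prod_normE !le_max !lexx orbT.
  exact: (lin_estimate _ _ _ _ _ _ l1 l2 d1 d2).
have d : 'd u x = dlin ('D_e1 u x) ('D_e2 u x) :> (R * R -> R).
  exact: (diff_unique (@dlin_continuous _ _) H).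
apply: DiffDef => //; apply/diff_locallyP; rewrite d; split => //.
exact: dlin_continuous.
Qed.

Lemma C1_derivable A u x v : open A -> C1_on A u -> A x -> derivable u x v.
Proof.
by move=> oA uA Ax; apply: diff_derivable; have [] := C1_diff _ _ _ oA uA Ax.
Qed.

Lemma C1_derive A u x v : open A -> C1_on A u -> A x ->
  'D_v u x = v.1 * 'D_e1 u x + v.2 * 'D_e2 u x.
Proof.
by move=> oA uA Ax; have [du E] := C1_diff _ _ _ oA uA Ax; rewrite deriveE ?E.
Qed.

Lemma C1_continuous A u x : open A -> C1_on A u -> A x -> {for x, continuous u}.
Proof.
move=> oA uA Ax; apply: differentiable_continuous.
by have [] := C1_diff _ _ _ oA uA Ax.
Qed.

Lemma is_derive1_curve A u (q1 q2 : R -> R) (t d1 d2 : R) :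
    open A -> C1_on A u -> A (q1 t, q2 t) ->
    is_derive t 1 q1 d1 -> is_derive t 1 q2 d2 ->
  is_derive t 1 (fun s => u (q1 s, q2 s))
    (d1 * 'D_e1 u (q1 t, q2 t) + d2 * 'D_e2 u (q1 t, q2 t)).
Proof.
move=> oA uA Aq [dq1 <-] [dq2 <-].
have diff1 : differentiable q1 t by exact: (derivable1_diffP _ _).1 dq1.
have diff2 : differentiable q2 t by exact: (derivable1_diffP _ _).1 dq2.
have diffq : differentiable (fun s => (q1 s, q2 s)) t.
  exact: differentiable_pair.
have [du Eu] := C1_diff _ _ _ oA uA Aq.
have diffc : differentiable (u \o (fun s => (q1 s, q2 s))) t.
  exact: differentiable_comp.
apply: DeriveDef; first exact: diff_derivable.
rewrite deriveE// diff_comp// /= Eu diff_pair//.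
by rewrite !deriveE.
Qed.

Lemma near_derive_eq A u w x v : open A -> A x -> (forall y, A y -> u y = w y) ->
  \forall y \near x, 'D_v u y = 'D_v w y.
Proof.
move=> oA Ax uw; have : \forall y \near x, A y by exact: open_nbhs_nbhs.
apply: filterS => y Ay; apply: near_eq_derive.
have : \forall z \near y, A z by exact: open_nbhs_nbhs.
by apply: filterS => z /uw.
Qed.

Lemma for_continuous_near_eq (a b : R * R -> R) x :
  (\forall y \near x, a y = b y) -> {for x, continuous a} -> {for x, continuous b}.
Proof.
move=> ab ca; rewrite /prop_for /continuous_at -(nbhs_singleton ab).
by apply: cvg_trans ca; apply: near_eq_cvg.
Qed.

Lemma C1_along_eq e A u w : open A -> (forall y, A y -> u y = w y) ->
  C1_along e A u -> C1_along e A w.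
Proof.
move=> oA uw uA x Ax; have [d c] := uA _ Ax.
have nuw : \forall y \near x, u y = w y.
  have : \forall z \near x, A z by exact: open_nbhs_nbhs.
  by apply: filterS => z /uw.
split; first exact: near_eq_derivable d.
by apply: for_continuous_near_eq c; exact: near_derive_eq uw.
Qed.

Lemma C1_on_eq A u w : open A -> (forall y, A y -> u y = w y) ->
  C1_on A u -> C1_on A w.
Proof.
by move=> oA uw [u1 u2]; split; [exact: C1_along_eq u1|exact: C1_along_eq u2].
Qed.

Lemma derive_add_scale u w (l : R) x v : derivable u x v -> derivable w x v ->
  'D_v (u + l *: w) x = 'D_v u x + l * 'D_v w x.
Proof.
move=> du dw; have dlw : derivable (l *: w) x v by exact: derivableZ.
by rewrite (deriveD du dlw) (deriveZ _ dw).
Qed.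

Lemma C1_along_add_scale e A u w (l : R) : open A ->
  C1_along e A u -> C1_along e A w -> C1_along e A (u + l *: w).
Proof.
move=> oA uA wA x Ax; have [d c] := uA _ Ax; have [d' c'] := wA _ Ax.
have dlw : derivable (l *: w) x e by exact: derivableZ.
split; first exact: derivableD d dlw.
have : {for x, continuous ('D_e u + l *: 'D_e w)}.
  by apply: cvgD; [exact: c|apply: cvgZl_tmp; exact: c'].
apply: for_continuous_near_eq.
have : \forall z \near x, A z by exact: open_nbhs_nbhs.
apply: filterS => y Ay; rewrite derive_add_scale; first by [].
- by have [] := uA _ Ay.
- by have [] := wA _ Ay.
Qed.

Lemma C1_on_add_scale A u w (l : R) : open A -> C1_on A u -> C1_on A w ->
  C1_on A (u + l *: w).
Proof.
move=> oA [u1 u2] [w1 w2]; split.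
  exact: C1_along_add_scale u1 w1.
exact: C1_along_add_scale u2 w2.
Qed.

Definition C2_on A u :=
  [/\ C1_on A u, C1_on A ('D_e1 u) & C1_on A ('D_e2 u)].

Lemma C2_on_add_scale A u w (l : R) : open A -> C2_on A u -> C2_on A w ->
  C2_on A (u + l *: w).
Proof.
move=> oA [u0 u1 u2] [w0 w1 w2]; split; first exact: C1_on_add_scale.
- apply: C1_on_eq (C1_on_add_scale A _ _ l oA u1 w1); first exact: oA.
  move=> y Ay; rewrite derive_add_scale; first by [].
    by case: u0 => u0 _; have [] := u0 _ Ay.
  by case: w0 => w0 _; have [] := w0 _ Ay.
- apply: C1_on_eq (C1_on_add_scale A _ _ l oA u2 w2); first exact: oA.
  move=> y Ay; rewrite derive_add_scale; first by [].
    by case: u0 => _ u0; have [] := u0 _ Ay.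
  by case: w0 => _ w0; have [] := w0 _ Ay.
Qed.

Lemma within_closure_continuous A (w : R * R -> R) x : open A ->
  {within closure A, continuous w} -> A x -> {for x, continuous w}.
Proof.
move=> oA cw Ax.
have := continuous_subspaceW (@subset_closure _ A) cw.
by rewrite continuous_open_subspace// => /(_ x); apply; rewrite inE.
Qed.

Lemma Ck_ext_continuous k A u x : open A -> Ck_ext k A u -> A x ->
  {for x, continuous u}.
Proof.
move=> oA uA Ax.
have [w cw wu] : exists2 w : R * R -> R, {within closure A, continuous w} &
    forall y, A y -> w y = u y by case: k uA => [|k] [].
apply: (for_continuous_near_eq w); last exact: within_closure_continuous cw Ax.
have : \forall z \near x, A z by exact: open_nbhs_nbhs.
by apply: filterS => z /wu.
Qed.

Lemma Ck_ext_C1_on k A u : open A -> Ck_ext k.+1 A u -> C1_on A u.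
Proof.
move=> oA [_ [du u1 u2]]; split=> x Ax; have [d1 d2] := du _ Ax.
  by split; [exact: d1|exact: Ck_ext_continuous u1 Ax].
by split; [exact: d2|exact: Ck_ext_continuous u2 Ax].
Qed.

Lemma Ck_ext_C2_on A u : open A -> Ck_ext 2 A u -> C2_on A u.
Proof.
move=> oA uA; have [_ [_ u1 u2]] := uA; split.
- exact: (Ck_ext_C1_on _ _ _ oA uA).
- exact: (Ck_ext_C1_on 0 _ _ oA u1).
- exact: (Ck_ext_C1_on 0 _ _ oA u2).
Qed.

End C1.

(** * Implicit functions and graphs *)

Section implicit.
Context {R : realType}.

Lemma near_dist_lt (x e : R) : 0 < e -> \forall t \near x, `|t - x| < e.
Proof. by move=> e0; exists e => //= t /=; rewrite distrC. Qed.

(** The point with coordinates w and v in the orthonormal basis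
    (- n.2, n.1), n, for a unit vector n. *)
Definition rot (n : R * R) (w v : R) : R * R :=
  (v * n.1 - w * n.2, v * n.2 + w * n.1).

Lemma rotK (n x : R * R) : n.1 ^+ 2 + n.2 ^+ 2 = 1 ->
  rot n (n.1 * x.2 - n.2 * x.1) (n.1 * x.1 + n.2 * x.2) = x.
Proof.
case: n x => [a b] [x y] /= ab; rewrite /rot /=.
have -> : (a * x + b * y) * a - (a * y - b * x) * b = x * (a ^+ 2 + b ^+ 2) by ring.
have -> : (a * x + b * y) * b + (a * y - b * x) * a = y * (a ^+ 2 + b ^+ 2) by ring.
by rewrite ab !mulr1.
Qed.

Lemma unit_coord_le1 (n : R * R) : n.1 ^+ 2 + n.2 ^+ 2 = 1 ->
  `|n.1| <= 1 /\ `|n.2| <= 1.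
Proof. by move=> n1; rewrite !ler_norml; split; apply/andP; split; nra. Qed.

Lemma rot_dist (n : R * R) (w v w' v' : R) : n.1 ^+ 2 + n.2 ^+ 2 = 1 ->
  `|(rot n w v).1 - (rot n w' v').1| <= `|w - w'| + `|v - v'| /\
  `|(rot n w v).2 - (rot n w' v').2| <= `|w - w'| + `|v - v'|.
Proof.
move=> /unit_coord_le1[n1 n2]; rewrite /rot /=.
have -> : v * n.1 - w * n.2 - (v' * n.1 - w' * n.2) =
  (v - v') * n.1 - (w - w') * n.2 by ring.
have -> : v * n.2 + w * n.1 - (v' * n.2 + w' * n.1) =
  (v - v') * n.2 + (w - w') * n.1 by ring.
split.
  rewrite (le_trans (ler_normB _ _))// !normrM addrC.
  by rewrite lerD// ler_piMr.
rewrite (le_trans (ler_normD _ _))// !normrM addrC.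
by rewrite lerD// ler_piMr.
Qed.

Lemma rot_continuous (n : R * R) (p q : R -> R) t :
  {for t, continuous p} -> {for t, continuous q} ->
  {for t, continuous (fun s => rot n (p s) (q s))}.
Proof.
move=> cp cq.
have c1 : {for t, continuous (fun s => q s * n.1 - p s * n.2)}.
  by apply: cvgB; apply: cvgM; [exact: cq|exact: cvg_cst|exact: cp|exact: cvg_cst].
have c2 : {for t, continuous (fun s => q s * n.2 + p s * n.1)}.
  by apply: cvgD; apply: cvgM; [exact: cq|exact: cvg_cst|exact: cp|exact: cvg_cst].
exact: (cvg_pair c1 c2).
Qed.

Variables (u : R * R -> R) (n : R * R) (A : set (R * R)) (w0 v0 c del : R).
Let D1 := 'D_e1 u.
Let D2 := 'D_e2 u.
(* a and b are the derivatives of u along the horizontal and the vertical axis. *)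
Let a x := - n.2 * D1 x + n.1 * D2 x.
Let b x := n.1 * D1 x + n.2 * D2 x.
Let box w v := `|w - w0| <= del /\ `|v - v0| <= del.

Hypothesis n1 : n.1 ^+ 2 + n.2 ^+ 2 = 1.
Hypothesis oA : open A.
Hypothesis uA : C2_on A u.
Hypothesis c0 : 0 < c.
Hypothesis del0 : 0 < del.
(* The cone condition: on the box, a is smaller in absolute value than - b. *)
Hypothesis boxP : forall w v, box w v ->
  [/\ A (rot n w v), `|a (rot n w v)| < c & b (rot n w v) < - c].
Hypothesis u0 : u (rot n w0 v0) = 0.

(** The increment of u is a combination of its derivatives a and b along the
    two axes, both taken at the same point, since the mean value theorem is used
    on the segment between the two points and the box is convex. *)
Lemma box_MVT w v w' v' : box w v -> box w' v' ->
  exists r, r \in `[0 : R, 1] /\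
   let xi := rot n (w + r * (w' - w)) (v + r * (v' - v)) in
   [/\ A xi, `|a xi| < c, b xi < - c &
     u (rot n w' v') - u (rot n w v) = (w' - w) * a xi + (v' - v) * b xi].
Proof.
move=> B1 B2; set d := rot n (w' - w) (v' - v).
have E r : rot n w v + (1 * r) *: d = rot n (w + r * (w' - w)) (v + r * (v' - v)).
  by rewrite mul1r /d /rot; congr (_, _); rewrite /= /GRing.scale/=; ring.
have boxr r : r \in `[0 : R, 1] -> box (w + r * (w' - w)) (v + r * (v' - v)).
  rewrite in_itv/= => /andP[r0 r1]; move: B1 B2; rewrite /box !ler_norml.
  move=> [/andP[? ?] /andP[? ?]] [/andP[? ?] /andP[? ?]].
  by split; apply/andP; split; nra.
have [u1 _ _] := uA.
have [|r rI] := @MVT_line R u (rot n w v) d 1.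
  move=> r /boxr/boxP[Ar _ _]; rewrite E.
  exact: (C1_derivable A).
have [Ar ar br] := boxP _ _ (boxr _ rI).
rewrite E mul1r scale1r => Eu; exists r; split => //; split => //.
move: Eu; rewrite (C1_derive A)// => Eu.
have <- : rot n w v + d = rot n w' v'.
  by rewrite /d /rot; congr (_, _) => /=; ring.
rewrite Eu /a /b /D1 /D2; set xi := rot n (w + _) _.
by rewrite /d /rot/=; ring.
Qed.

Lemma box_decr w v v' : box w v -> box w v' -> v < v' ->
  u (rot n w v') < u (rot n w v).
Proof.
move=> B1 B2 vv; have [r [_ []]] := box_MVT _ _ _ _ B1 B2.
set xi := rot _ _ _ => _ _ br E.
rewrite -subr_lt0 E subrr mul0r add0r pmulr_rlt0 ?subr_gt0//.
by apply: lt_trans br _; rewrite oppr_lt0.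
Qed.

Lemma box0 : box w0 v0.
Proof. by split; rewrite subrr normr0 ltW. Qed.

(** From the centre, where u vanishes, one gets to the upper side of the box by
    an increment whose vertical part del dominates. *)
Lemma box_top w : `|w - w0| <= del -> u (rot n w (v0 + del)) < 0.
Proof.
move=> wd.
have Bt : box w (v0 + del) by split => //; rewrite addrAC subrr add0r gtr0_norm.
have [r [_ []]] := box_MVT _ _ _ _ box0 Bt; set xi := rot _ (_ + r * _) _.
rewrite u0 subr0 => _ ar br ->; rewrite addrAC subrr add0r.
have := ler_norm ((w - w0) * a xi); rewrite normrM.
have := ler_pM (normr_ge0 _) (normr_ge0 _) wd (ltW ar).
move: br; rewrite -(ltr_pM2l del0).
by lra.
Qed.

Lemma box_bot w : `|w - w0| <= del -> 0 < u (rot n w (v0 - del)).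
Proof.
move=> wd.
have Bt : box w (v0 - del).
  by split => //; rewrite addrAC subrr add0r normrN gtr0_norm.
have [r [_ []]] := box_MVT _ _ _ _ box0 Bt; set xi := rot _ (_ + r * _) _.
rewrite u0 subr0 => _ ar br ->; rewrite addrAC subrr add0r.
have := ler_norm (- ((w - w0) * a xi)); rewrite normrN normrM.
have := ler_pM (normr_ge0 _) (normr_ge0 _) wd (ltW ar).
move: br; rewrite -(ltr_pM2l del0).
by lra.
Qed.

Definition graph_fun w := xget v0 [set v | `|v - v0| <= del /\ u (rot n w v) = 0].

Lemma graph_funP w : `|w - w0| <= del -> box w (graph_fun w) /\ u (rot n w (graph_fun w)) = 0.
Proof.
move=> wd.
have bI v : v \in `[v0 - del, v0 + del] -> box w v.
  by rewrite in_itv/= => /andP[? ?]; split => //; rewrite ler_norml; apply/andP; split; lra.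
have le : v0 - del <= v0 + del by rewrite lerD2l; move: del0; lra.
have ct : {within `[v0 - del, v0 + del], continuous (fun v => u (rot n w v))}.
  apply: continuous_in_subspaceT => v; rewrite inE => /bI/boxP[Av _ _].
  have [u1 _ _] := uA.
  have cr : {for v, continuous (fun s => rot n (cst w s) (id s))}.
    by apply: rot_continuous; [exact: cvg_cst|exact: cvg_id].
  exact: (continuous_comp cr (C1_continuous _ _ _ oA u1 Av)).
have [|v /bI bv uv] := @IVT _ _ _ _ 0 le ct.
  by rewrite ge_min le_max (ltW (box_top _ wd)) (ltW (box_bot _ wd)) orbT.
have := @xgetI _ v0 [set v | `|v - v0| <= del /\ u (rot n w v) = 0] v.
by rewrite -/(graph_fun w) => -[//|]; [case: bv|move=> ? ?].
Qed.

Lemma graph_fun_sublevel w v : box w v -> u (rot n w v) < 0 <-> graph_fun w < v.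
Proof.
move=> B1; have [wd _] := B1; have [B2 E] := graph_funP _ wd; split; last first.
  by rewrite -E; exact: box_decr.
move=> uv; rewrite ltNge; apply/negP; rewrite le_eqVlt => /predU1P[vE|vl].
  by move: uv; rewrite vE E ltxx.
by have := box_decr _ _ _ B1 B2 vl; rewrite E ltNge (ltW uv).
Qed.

(** [box_MVT] between two points of the graph, at which u vanishes, gives the
    difference quotient as the value of - a / b at an intermediate point. *)
Lemma graph_fun_slope w w' : `|w - w0| <= del -> `|w' - w0| <= del ->
  exists r, r \in `[0 : R, 1] /\
   let xi := rot n (w + r * (w' - w)) (graph_fun w + r * (graph_fun w' - graph_fun w)) in
   [/\ A xi, `|a xi| < c, b xi < - c &
     graph_fun w' - graph_fun w = (w' - w) * (- a xi / b xi)].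
Proof.
move=> wd wd'; have [B1 E1] := graph_funP _ wd; have [B2 E2] := graph_funP _ wd'.
have [r [rI [Ar ar br]]] := box_MVT _ _ _ _ B1 B2; rewrite E1 E2 subrr => E.
exists r; split => //; split => //; set xi := rot _ _ _ in Ar ar br E *.
have b0 : b xi != 0 by rewrite lt_eqF// (lt_trans br)// oppr_lt0.
apply: (mulIf b0); rewrite -mulrA divfK// mulrN.
by apply/eqP; rewrite -subr_eq0 opprK addrC -E.
Qed.

(** The slope - a / b is at most 1 in absolute value, as |a| < c < - b. *)
Lemma graph_fun_lipschitz w w' : `|w - w0| <= del -> `|w' - w0| <= del ->
  `|graph_fun w' - graph_fun w| <= `|w' - w|.
Proof.
move=> wd wd'; have [r [_ []]] := graph_fun_slope _ _ wd wd'.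
set xi := rot _ _ _ => _ ar br ->.
have b0 : b xi < 0 by apply: lt_trans br _; rewrite oppr_lt0.
rewrite normrM ler_piMr// normrM normrN normfV (ltr0_norm b0).
by rewrite ler_pdivrMr ?oppr_gt0// mul1r ltW// (lt_trans ar)// ltrNr.
Qed.

Lemma graph_fun_continuous w : `|w - w0| < del -> {for w, continuous graph_fun}.
Proof.
move=> wd; apply/cvgrPdist_lt => e e0.
have d0 : 0 < del - `|w - w0| by rewrite subr_gt0.
apply: filterS2 (near_dist_lt w _ d0) (near_dist_lt w _ e0) => t td te.
have {}td : `|t - w0| <= del.
  have -> : t - w0 = (t - w) + (w - w0) by ring.
  by rewrite (le_trans (ler_normD _ _))// -lerBrDr ltW.
by rewrite distrC (le_lt_trans (graph_fun_lipschitz _ _ (ltW wd) td)).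
Qed.

Let F x := - a x / b x.
Definition dgraph_fun w := F (rot n w (graph_fun w)).

(** The intermediate point in [graph_fun_slope] tends to the point of the graph
    by the Lipschitz bound, and - a / b is continuous there. *)
Lemma is_derive_graph_fun w : `|w - w0| < del -> is_derive w 1 graph_fun (dgraph_fun w).
Proof.
move=> wd; have [B1 _] := graph_funP _ (ltW wd); have [Aw _ bw] := boxP _ _ B1.
have [[uA1 uA2] _ _] := uA; have [_ c1] := uA1 _ Aw; have [_ c2] := uA2 _ Aw.
have ca : {for rot n w (graph_fun w), continuous a}.
  by apply: cvgD; apply: cvgM; [exact: cvg_cst|exact: c1|exact: cvg_cst|exact: c2].
have cb : {for rot n w (graph_fun w), continuous b}.
  by apply: cvgD; apply: cvgM; [exact: cvg_cst|exact: c1|exact: cvg_cst|exact: c2].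
have b0 : b (rot n w (graph_fun w)) != 0.
  by rewrite lt_eqF// (lt_trans bw)// oppr_lt0.
have cF : {for rot n w (graph_fun w), continuous F}.
  by apply: cvgM; [apply: cvgN; exact: ca|apply: cvgV => //; exact: cb].
have d0 : 0 < del - `|w - w0| by rewrite subr_gt0.
apply: cvg_is_derive; apply/cvgrPdist_lt => e e0.
have : \forall y \near rot n w (graph_fun w), `|F (rot n w (graph_fun w)) - F y| < e.
  by move/cvgrPdist_lt/(_ _ e0) : cF.
move=> /near_ball_box[r r0 rP].
near=> h.
have h0 : h != 0 by near: h; exact: nbhs_dnbhs_neq.
have hr : `|h| < r / 2.
  near: h; apply: dnbhs0_lt; first by rewrite divr_gt0.
have td : `|h + w - w0| <= del.
  rewrite -addrA (le_trans (ler_normD _ _))// -lerBrDr ltW//.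
  by near: h; apply: dnbhs0_lt.
rewrite /= scaler1.
have lip := graph_fun_lipschitz _ _ (ltW wd) td; rewrite addrK in lip.
have [s [sI []]] := graph_fun_slope _ _ (ltW wd) td.
rewrite addrK; set xi := rot _ _ _ => _ _ _ ->.
rewrite /GRing.scale/= mulKf//.
have {}hr : `|w + s * h - w| + `|graph_fun w + s * (graph_fun (h + w) - graph_fun w) - graph_fun w| < r.
  rewrite !(addrAC _ _ (- _)) !subrr !add0r !normrM.
  move: sI; rewrite in_itv/= => /andP[s0 s1]; rewrite (ger0_norm s0).
  have l1 := ler_piMl (normr_ge0 h) s1.
  have l2 := ler_piMl (normr_ge0 (graph_fun (h + w) - graph_fun w)) s1.
  by move: hr lip l1 l2; lra.
have [r1 r2] := rot_dist n (w + s * h) (graph_fun w + s * (graph_fun (h + w) - graph_fun w))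
  w (graph_fun w) n1.
by apply: rP; [exact: le_lt_trans r1 hr|exact: le_lt_trans r2 hr].
Unshelve. all: by end_near. Qed.

Lemma is_derive_div (f g : R -> R) (t df dg : R) : g t != 0 ->
  is_derive t 1 f df -> is_derive t 1 g dg ->
  is_derive t 1 (fun s => f s / g s) ((df * g t - f t * dg) / g t ^+ 2).
Proof.
move=> g0 Df Dg; have DV := is_deriveV g0 Dg.
have D := @is_deriveM R R f (fun s => (g s)^-1) t 1 _ _ Df DV.
apply: is_derive_eq D _; rewrite /GRing.scale/=.
by field.
Qed.

Lemma is_derive_comb (f g : R -> R) (k l t df dg : R) :
  is_derive t 1 f df -> is_derive t 1 g dg ->
  is_derive t 1 (fun s => k * f s + l * g s) (k * df + l * dg).
Proof.
move=> Df Dg; have DF := @is_deriveM R R (cst k) f t 1 _ _ (is_derive_cst _ _ _) Df.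
have DG := @is_deriveM R R (cst l) g t 1 _ _ (is_derive_cst _ _ _) Dg.
have D := @is_deriveD R R R _ _ t 1 _ _ DF DG.
by apply: is_derive_eq D _; rewrite !scaler0 !addr0.
Qed.

Let Q w := rot n w (graph_fun w).
Let dQ1 w := dgraph_fun w * n.1 - n.2.
Let dQ2 w := dgraph_fun w * n.2 + n.1.
Let dD (D : R * R -> R) w := dQ1 w * 'D_e1 D (Q w) + dQ2 w * 'D_e2 D (Q w).

Lemma is_derive_along_graph_fun (D : R * R -> R) w : `|w - w0| < del -> C1_on A D ->
  is_derive w 1 (fun s => D (Q s)) (dD D w).
Proof.
move=> wd DA; have [B1 _] := graph_funP _ (ltW wd); have [Aw _ _] := boxP _ _ B1.
have di := is_derive_graph_fun _ wd.
apply: (is_derive1_curve A D (fun s => graph_fun s * n.1 - s * n.2)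
  (fun s => graph_fun s * n.2 + s * n.1) w (dQ1 w) (dQ2 w) oA DA Aw).
- have -> : (fun s => graph_fun s * n.1 - s * n.2) = (fun s => n.1 * graph_fun s + - n.2 * s).
    by apply/funext => s; ring.
  have -> : dQ1 w = n.1 * dgraph_fun w + - n.2 * 1 by rewrite /dQ1; ring.
  exact: is_derive_comb di (is_derive_id w 1).
- have -> : (fun s => graph_fun s * n.2 + s * n.1) = (fun s => n.2 * graph_fun s + n.1 * s).
    by apply/funext => s; ring.
  have -> : dQ2 w = n.2 * dgraph_fun w + n.1 * 1 by rewrite /dQ2; ring.
  exact: is_derive_comb di (is_derive_id w 1).
Qed.

(** Derivative of - a / b along the graph, by the quotient rule. *)
Definition ddgraph_fun w :=
  ((n.2 * dD D1 w + - n.1 * dD D2 w) * b (Q w) -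
   (- a (Q w)) * (n.1 * dD D1 w + n.2 * dD D2 w)) / b (Q w) ^+ 2.

Lemma b_neq0 w : `|w - w0| < del -> b (Q w) != 0.
Proof.
move=> wd; have [B1 _] := graph_funP _ (ltW wd); have [_ _ bw] := boxP _ _ B1.
by rewrite lt_eqF// (lt_trans bw)// oppr_lt0.
Qed.

Lemma is_derive_dgraph_fun w : `|w - w0| < del -> is_derive w 1 dgraph_fun (ddgraph_fun w).
Proof.
move=> wd; have [_ uD1 uD2] := uA.
have H1 := is_derive_along_graph_fun _ _ wd uD1.
have H2 := is_derive_along_graph_fun _ _ wd uD2.
have DN : is_derive w 1 (fun s => - a (Q s)) (n.2 * dD D1 w + - n.1 * dD D2 w).
  have -> : (fun s => - a (Q s)) = (fun s => n.2 * D1 (Q s) + - n.1 * D2 (Q s)).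
    by apply/funext => s; rewrite /a; ring.
  exact: (is_derive_comb _ _ _ _ _ _ _ H1 H2).
have DD : is_derive w 1 (fun s => b (Q s)) (n.1 * dD D1 w + n.2 * dD D2 w).
  exact: (is_derive_comb _ _ _ _ _ _ _ H1 H2).
exact: (is_derive_div (fun s => - a (Q s)) (fun s => b (Q s)) _ _ _ (b_neq0 _ wd) DN DD).
Qed.

Lemma is_derive_continuous (f : R -> R) (t df : R) : is_derive t 1 f df ->
  {for t, continuous f}.
Proof. by move=> [/derivable1_diffP/differentiable_continuous]. Qed.

Lemma dD_continuous (D : R * R -> R) w : `|w - w0| < del -> C1_on A D ->
  {for w, continuous (dD D)}.
Proof.
move=> wd [DA1 DA2]; have [B1 _] := graph_funP _ (ltW wd); have [Aw _ _] := boxP _ _ B1.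
have cd := is_derive_continuous _ _ _ (is_derive_dgraph_fun _ wd).
have ci := graph_fun_continuous _ wd.
have cQ : {for w, continuous Q} by apply: rot_continuous => //; exact: cvg_id.
have [_ c1] := DA1 _ Aw; have [_ c2] := DA2 _ Aw.
apply: cvgD; apply: cvgM.
- by apply: cvgB; [apply: cvgM; [exact: cd|exact: cvg_cst]|exact: cvg_cst].
- exact: (continuous_comp cQ c1).
- by apply: cvgD; [apply: cvgM; [exact: cd|exact: cvg_cst]|exact: cvg_cst].
- exact: (continuous_comp cQ c2).
Qed.

Lemma ddgraph_fun_continuous w : `|w - w0| < del -> {for w, continuous ddgraph_fun}.
Proof.
move=> wd; have [_ uD1 uD2] := uA.
have c1 := dD_continuous _ _ wd uD1; have c2 := dD_continuous _ _ wd uD2.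
have d1 := is_derive_continuous _ _ _ (is_derive_along_graph_fun _ _ wd uD1).
have d2 := is_derive_continuous _ _ _ (is_derive_along_graph_fun _ _ wd uD2).
have ca : {for w, continuous (fun s => a (Q s))}.
  by apply: cvgD; apply: cvgM; [exact: cvg_cst|exact: d1|exact: cvg_cst|exact: d2].
have cb : {for w, continuous (fun s => b (Q s))}.
  by apply: cvgD; apply: cvgM; [exact: cvg_cst|exact: d1|exact: cvg_cst|exact: d2].
apply: cvgM; first (apply: cvgB; apply: cvgM).
- by apply: cvgD; apply: cvgM; [exact: cvg_cst|exact: c1|exact: cvg_cst|exact: c2].
- exact: cb.
- by apply: cvgN; exact: ca.
- by apply: cvgD; apply: cvgM; [exact: cvg_cst|exact: c1|exact: cvg_cst|exact: c2].
apply: cvgV; first by rewrite expf_neq0// b_neq0.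
by rewrite expr2; apply: cvgM; exact: cb.
Qed.

Lemma graph_fun_C2_line : exists2 gam, C2_line gam &
  forall w v, `|w - w0| <= del / 4 -> `|v - v0| <= del ->
    u (rot n w v) < 0 <-> gam w < v.
Proof.
have [gam gamC2 gamE] := C2_line_extension graph_fun dgraph_fun ddgraph_fun w0 del del0
  is_derive_graph_fun is_derive_dgraph_fun ddgraph_fun_continuous.
exists gam => // w v wd vd; rewrite gamE//.
by apply: graph_fun_sublevel; split => //; move: del0 wd; lra.
Qed.

End implicit.

Section regular_zero.
Context {R : realType}.

(** The unit vector n points along - grad u x0, so that at x0 the horizontal
    derivative of u is 0 and the vertical one is minus the length of the
    gradient; by continuity they are separated by half of that length near x0. *)
Lemma sublevel_graph (u : R * R -> R) (A : set (R * R)) (x0 : R * R) :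
    open A -> C2_on A u -> A x0 -> u x0 = 0 -> 0 < enorm (grad u x0) ->
  exists r n (gam : R -> R), [/\ 0 < r, enorm n = 1, C2_line gam &
    forall x, enorm (x - x0) < r -> A x /\
      (u x < 0 <-> gam (n.1 * x.2 - n.2 * x.1) < n.1 * x.1 + n.2 * x.2)].
Proof.
move=> oA uA Ax0 ux0; set p := 'D_e1 u x0; set q := 'D_e2 u x0.
set G := enorm _ => G0.
have G2 : G ^+ 2 = p ^+ 2 + q ^+ 2 by rewrite sqr_enorm.
pose n : R * R := (- p / G, - q / G).
have nn : n.1 ^+ 2 + n.2 ^+ 2 = 1.
  rewrite /n /= !exprMn !sqrrN -mulrDl exprVn -G2 mulfV// expf_neq0//.
  by rewrite gt_eqF.
pose w0 := n.1 * x0.2 - n.2 * x0.1; pose v0 := n.1 * x0.1 + n.2 * x0.2.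
have x0E : rot n w0 v0 = x0 by exact: rotK.
pose a x := - n.2 * 'D_e1 u x + n.1 * 'D_e2 u x.
pose b x := n.1 * 'D_e1 u x + n.2 * 'D_e2 u x.
have a0 : a x0 = 0 by rewrite /a -/p -/q /n /=; ring.
have b0 : b x0 = - G.
  rewrite /b -/p -/q /n /=.
  have -> : - p / G * p + - q / G * q = - ((p ^+ 2 + q ^+ 2) / G) by ring.
  by rewrite -G2 expr2 mulfK// gt_eqF.
have [[uA1 uA2] _ _] := uA; have [_ c1] := uA1 _ Ax0; have [_ c2] := uA2 _ Ax0.
have ca : {for x0, continuous a}.
  by apply: cvgD; apply: cvgM; [exact: cvg_cst|exact: c1|exact: cvg_cst|exact: c2].
have cb : {for x0, continuous b}.
  by apply: cvgD; apply: cvgM; [exact: cvg_cst|exact: c1|exact: cvg_cst|exact: c2].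
have G20 : 0 < G / 2 by rewrite divr_gt0.
have na : \forall y \near x0, `|a x0 - a y| < G / 2.
  by move/cvgrPdist_lt/(_ _ G20) : ca.
have nb : \forall y \near x0, `|b x0 - b y| < G / 2.
  by move/cvgrPdist_lt/(_ _ G20) : cb.
have nA : \forall y \near x0, A y by exact: open_nbhs_nbhs.
have [r r0 rP] := near_ball_box _ _ (filterS3 _ (fun y h1 h2 h3 =>
  And3 h1 h2 h3) nA na nb).
(* Points of the box are within 2 * del of x0 in each coordinate. *)
pose del := r / 3.
have del0 : 0 < del by rewrite divr_gt0.
have boxP w v : `|w - w0| <= del /\ `|v - v0| <= del ->
    [/\ A (rot n w v), `|a (rot n w v)| < G / 2 & b (rot n w v) < - (G / 2)].
  move=> [wd vd]; have [d1 d2] := rot_dist n w v w0 v0 nn.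
  rewrite x0E in d1 d2; have ddr : `|w - w0| + `|v - v0| < r.
    by move: wd vd; rewrite /del; move: r0; lra.
  have [Ay ay bY] := rP _ (le_lt_trans d1 ddr) (le_lt_trans d2 ddr).
  split => //; first by move: ay; rewrite a0 sub0r normrN.
  by move: bY; rewrite b0 ltr_norml => /andP[]; lra.
have u0 : u (rot n w0 v0) = 0 by rewrite x0E.
have [gam gamC2 gamP] := graph_fun_C2_line u n A w0 v0 (G / 2) del nn oA uA G20 del0 boxP u0.
have [n1 n2] := unit_coord_le1 _ nn.
have bnd (k l d1 d2 : R) : `|k| <= 1 -> `|l| <= 1 -> `|d1| < del / 8 ->
    `|d2| < del / 8 -> `|k * d1 + l * d2| <= del / 4.
  move=> k1 l1 h1 h2; rewrite (le_trans (ler_normD _ _))// !normrM.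
  have e1 := ler_piMl (normr_ge0 d1) k1; have e2 := ler_piMl (normr_ge0 d2) l1.
  by move: e1 e2 h1 h2; lra.
exists (del / 8), n, gam; split => //; first by rewrite divr_gt0.
  by rewrite /enorm nn sqrtr1.
move=> x xr.
have xr1 : `|x.1 - x0.1| < del / 8 := le_lt_trans (coord1_le_enorm (x - x0)) xr.
have xr2 : `|x.2 - x0.2| < del / 8 := le_lt_trans (coord2_le_enorm (x - x0)) xr.
set w := n.1 * x.2 - _; set v := n.1 * x.1 + _.
have wd : `|w - w0| <= del / 4.
  have -> : w - w0 = n.1 * (x.2 - x0.2) + - n.2 * (x.1 - x0.1).
    by rewrite /w /w0; ring.
  by apply: bnd => //; rewrite normrN.
have vd : `|v - v0| <= del / 4.
  have -> : v - v0 = n.1 * (x.1 - x0.1) + n.2 * (x.2 - x0.2).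
    by rewrite /v /v0; ring.
  exact: bnd.
have le4 : del / 4 <= del by move: del0; lra.
have xE : rot n w v = x by exact: rotK.
have [Ax _ _] := boxP w v (conj (le_trans wd le4) (le_trans vd le4)).
have := gamP w v wd (le_trans vd le4); rewrite xE in Ax *.
by split.
Qed.

End regular_zero.

(** * Compactness, connectedness and uniform smallness *)

Section topology.
Context {R : realType}.
Implicit Types (A D : set (R * R)) (x y v : R * R).

Lemma near_norm_lt y (e : R) : 0 < e -> \forall x \near y, `|x - y| < e.
Proof.
move=> e0; apply/nbhs_ballP; exists e => // x.
by rewrite -ball_normE /= distrC.
Qed.

Lemma near_normP (P : set (R * R)) y : (\forall x \near y, P x) ->
  exists2 r : R, 0 < r & forall x, `|x - y| < r -> P x.
Proof.
move=> /nbhs_ballP[r r0 rP]; exists r => // x xr; apply: rP.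
by rewrite -ball_normE /= distrC.
Qed.

Lemma bounded_compact_closure A : bounded_set A -> compact (closure A).
Proof.
move=> /ex_strict_bound_gt0[M M0 AM].
have cS : compact (`[- M, M]%classic `*` `[- M, M]%classic : set (R * R)).
  by apply: compact_setX; exact: segment_compact.
apply: (subclosed_compact _ cS); first exact: closed_closure.
have -> : `[- M, M]%classic `*` `[- M, M]%classic =
    closure (`[- M, M]%classic `*` `[- M, M]%classic : set (R * R)).
  by apply/closure_id; apply: compact_closed; [exact: norm_hausdorff|exact: cS].
apply: closureS => x /AM /=; rewrite prod_normE gt_max => /andP[x1 x2].
by split; rewrite /= in_itv/= -ler_norml ltW.
Qed.

Lemma closure_setU_bd A : closure A = A `|` bd A.
Proof.
apply/seteqP; split=> [x clx|x [/subset_closure//|[]//]].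
have [Ax|nAx] := pselect (A x); [by left|right; split => //].
by move=> /interior_subset.
Qed.

Lemma open_not_bd A x : open A -> A x -> ~ bd A x.
Proof. by move=> oA Ax [_]; apply; exact: open_nbhs_nbhs. Qed.

(** The suprema and infima are taken in the reals, where the supremum of the
    empty set is 0; this is why r is assumed nonnegative. *)
Lemma hausdorff_dist_le (A B : set (R * R)) (r : R) : 0 <= r ->
    (forall x, A x -> exists2 y, B y & enorm (x - y) <= r) ->
    (forall y, B y -> exists2 x, A x & enorm (x - y) <= r) ->
  hausdorff_dist A B <= r.
Proof.
move=> r0 AB BA.
have S (I J : set (R * R)) (f : R * R -> R * R -> R) :
    (forall x y, 0 <= f x y) ->
    (forall x, I x -> exists2 y, J y & f x y <= r) ->
    sup [set inf [set f a b | b in J] | a in I] <= r.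
  move=> f0 IJ; have [->|/set0P I0] := eqVneq I set0.
    by rewrite image_set0 sup0.
  apply: ge_sup; first exact: image_nonempty.
  move=> _ [a /IJ[b Jb fr] <-]; apply: le_trans fr; apply: ge_inf.
    by exists 0 => _ [c _ <-].
  by exists b.
rewrite /hausdorff_dist ge_max; apply/andP; split.
  by apply: (S _ _ (fun a b => enorm (a - b))); [move=> x y; exact: enorm_ge0|].
apply: (S _ _ (fun b a => enorm (a - b))) => [x y|y By]; first exact: enorm_ge0.
by have [x Ax xy] := BA _ By; exists x.
Qed.

Lemma segment_component A x v (s : R) : 0 <= s ->
  (forall t, 0 <= t <= s -> A (x + t *: v)) ->
  connected_component A x (x + s *: v).
Proof.
move=> s0 sA; exists ((fun t : R => x + t *: v) @` `[0, s]); last first.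
  by exists s => //=; rewrite in_itv/= s0 lexx.
split; last exact: segment_connected.
- by exists 0; rewrite ?scale0r ?addr0//= in_itv/= lexx s0.
- by move=> z [t /= ts <-]; apply: sA; move: ts; rewrite in_itv.
Qed.

Lemma ball_component A y (r : R) x x' :
  (forall z, `|z - y| < r -> A z) -> `|x - y| < r -> `|x' - y| < r ->
  connected_component A x x'.
Proof.
move=> rA xr xr'.
have -> : x' = x + 1 *: (x' - x) by rewrite scale1r addrC subrK.
apply: segment_component => // t /andP[t0 t1]; apply: rA.
have -> : x + t *: (x' - x) - y = (1 - t) *: (x - y) + t *: (x' - y).
  case: x x' y {xr xr'} => [a b] [a' b'] [c d].
  by congr (_, _); rewrite /= /GRing.scale/=; ring.
rewrite (le_lt_trans (ler_normD _ _))// !normrZ (ger0_norm t0) ger0_norm ?subr_ge0//.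
by have [tp|] := ltP 0 t; nra.
Qed.

Lemma near2_point (I : Type) (F : set_system I) (P : R * R -> I -> Prop) y :
  Filter F -> (\forall x \near y & i \near F, P x i) -> \forall i \near F, P y i.
Proof.
move=> FF [[U V] /= [Uy FV] UVP]; apply: filterS FV => i Vi.
by apply: (UVP (y, i)); split => //=; exact: nbhs_singleton.
Qed.

Lemma near2_within (I : Type) (F : set_system I) A (P : R * R -> I -> Prop) y :
  Filter F -> (\forall z \near filter_prod (within A (nbhs y)) F, P z.1 z.2) ->
  \forall x \near y & i \near F, A x -> P x i.
Proof.
move=> FF [[U V] /= [Uy FV] UVP]; exists (fun x => A x -> U x, V); first by split.
by move=> [x i] [/= Ux Vi] Ax; apply: (UVP (x, i)); split => //=; exact: Ux.
Qed.

Lemma cvg_add_scale A (a b : R * R -> R) y :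
  a @ within A (nbhs y) --> a y -> b @ within A (nbhs y) --> b y ->
  (fun z : (R * R) * R => a z.1 + z.2 * b z.1) @
    filter_prod (within A (nbhs y)) 0^'+ --> a y.
Proof.
move=> ca cb.
have c1 : (fun z : (R * R) * R => a z.1) @ filter_prod (within A (nbhs y)) 0^'+ --> a y.
  exact: cvg_comp cvg_fst ca.
have c2 : (fun z : (R * R) * R => b z.1) @ filter_prod (within A (nbhs y)) 0^'+ --> b y.
  exact: cvg_comp cvg_fst cb.
have c3 : (fun z : (R * R) * R => z.2) @ filter_prod (within A (nbhs y)) 0^'+ --> (0 : R).
  apply: (cvg_trans cvg_snd); exact: cvg_at_right_filter cvg_id.
have := cvgD c1 (cvgM c3 c2); rewrite mul0r addr0.
exact.
Qed.

Lemma near_add_scale_lt A (a b : R * R -> R) y (c : R) :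
  a @ within A (nbhs y) --> a y -> b @ within A (nbhs y) --> b y -> a y < c ->
  \forall x \near y & l \near 0^'+, A x -> a x + l * b x < c.
Proof.
move=> ca cb ac.
apply: (near2_within _ _ _ (fun x l => a x + l * b x < c)).
by have /cvgr_lt/(_ _ ac) := cvg_add_scale _ _ _ _ ca cb.
Qed.

Lemma near_add_scale_gt A (a b : R * R -> R) y (c : R) :
  a @ within A (nbhs y) --> a y -> b @ within A (nbhs y) --> b y -> c < a y ->
  \forall x \near y & l \near 0^'+, A x -> c < a x + l * b x.
Proof.
move=> ca cb ac.
apply: (near2_within _ _ _ (fun x l => c < a x + l * b x)).
by have /cvgr_gt/(_ _ ac) := cvg_add_scale _ _ _ _ ca cb.
Qed.

End topology.

(** * Monotonicity along the descent direction *)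

Section descent.
Context {R : realType}.
Implicit Types (A D : set (R * R)) (u g h : R * R -> R) (x y d : R * R).

(** On the segments x + s d with x close to y and s small, the functions
    s -> u (x + s d) decrease strictly.  The neighbourhood and the bound on s are
    given by the same r, which is to be uniform for a family of functions u. *)
Definition decreasing_near u A y d (r : R) := forall x, `|x - y| < r ->
  forall s, `|s| < r -> A (x + s *: d) /\
  forall s', `|s'| < r -> s < s' -> u (x + s' *: d) < u (x + s *: d).

(** The radius is divided by 2 (|d| + 1) so that x + s d stays within distance
    r of y. *)
Lemma derive_decreasing_near u A y d (r : R) : 0 < r ->
    (forall x, `|x - y| < r ->
      [/\ A x, derivable u x d & 'D_d u x < 0]) ->
  decreasing_near u A y d (r / (2 * (`|d| + 1))).
Proof.
move=> r0 dP.
have d1 : 0 < `|d| + 1 by rewrite ltr_wpDl.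
set k := r / _; have k0 : 0 < k by rewrite divr_gt0// mulr_gt0.
have kd : k * (`|d| + 1) = r / 2.
  by rewrite /k; field; rewrite gt_eqF.
have B x s : `|x - y| < k -> `|s| < k -> `|x + s *: d - y| < r.
  move=> xk sk; rewrite addrAC (le_lt_trans (ler_normD _ _))// normrZ.
  have := ler_wpM2r (normr_ge0 d) (ltW sk); have := normr_ge0 d.
  by move: kd xk k0; nra.
move=> x xk s sk; split; first by have [] := dP _ (B _ _ xk sk).
move=> s' sk' ss'.
have E (q : R) : x + s *: d + q *: d = x + (s + q) *: d.
  by rewrite -addrA -scalerDl.
have I (q : R) : q \in `[0 : R, 1] -> `|s + (s' - s) * q| < k.
  rewrite in_itv/= => /andP[q0 q1]; move: sk sk'; rewrite !ltr_norml.
  by move=> /andP[? ?] /andP[? ?]; apply/andP; split; nra.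
have [|q qI] := @MVT_line R u (x + s *: d) d (s' - s).
  by move=> q /I qk; rewrite E; have [] := dP _ (B _ _ xk qk).
rewrite !E (addrC s (s' - s)) subrK => Eu.
have [_ _ D0] := dP _ (B _ _ xk (I _ qI)).
by rewrite -subr_lt0 Eu pmulr_rlt0// subr_gt0.
Qed.

Lemma C1_along_any A u d : open A -> C1_on A u -> C1_along d A u.
Proof.
move=> oA uA x Ax; split; first exact: (C1_derivable A).
have [uA1 uA2] := uA; have [_ c1] := uA1 _ Ax; have [_ c2] := uA2 _ Ax.
have : {for x, continuous (fun y => d.1 * 'D_e1 u y + d.2 * 'D_e2 u y)}.
  by apply: cvgD; apply: cvgM; [exact: cvg_cst|exact: c1|exact: cvg_cst|exact: c2].
apply: for_continuous_near_eq.
have : \forall z \near x, A z by exact: open_nbhs_nbhs.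
by apply: filterS => z Az; rewrite (C1_derive A u z d oA uA Az).
Qed.

Lemma continuous_within A u y : {for y, continuous u} -> u @ within A (nbhs y) --> u y.
Proof. by move=> cu; apply: cvg_within_filter; exact: cu. Qed.

Lemma derive_opp_grad A u y : open A -> C1_on A u -> A y ->
  0 < enorm (grad u y) -> 'D_(- grad u y) u y < 0.
Proof.
move=> oA uA Ay; rewrite enorm_gt0 (C1_derive A u y _ oA uA Ay) /= => H.
by rewrite -oppr_gt0 opprD -!mulNr !opprK -!expr2.
Qed.

(** With d = - grad g y the derivative of g along d is negative at y; as the
    derivatives of g and h along d are continuous, that of g + l h is negative
    near y for small l. *)
Lemma regular_decreasing A g h y : open A -> C1_on A g -> C1_on A h -> A y ->
    0 < enorm (grad g y) ->
  exists d (r : R), [/\ 0 < r, decreasing_near g A y d r &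
    \forall l \near 0^'+, decreasing_near (g + l *: h) A y d r].
Proof.
move=> oA gA hA Ay gy; pose d := - grad g y.
have Dg0 : 'D_d g y < 0 by exact: (derive_opp_grad A g y oA gA Ay gy).
have gd := C1_along_any _ _ d oA gA; have hd := C1_along_any _ _ d oA hA.
have [_ cg] := gd _ Ay; have [_ ch] := hd _ Ay.
have [[U V] /= [Uy FV] UVP] := near_add_scale_lt A ('D_d g) ('D_d h) y 0
  (continuous_within _ _ _ cg) (continuous_within _ _ _ ch) Dg0.
have nA : \forall z \near y, A z by exact: open_nbhs_nbhs.
have ng : \forall z \near y, 'D_d g z < 0 by move/cvgr_lt/(_ _ Dg0) : cg.
have : \forall z \near y, [/\ A z, 'D_d g z < 0 & U z].
  by apply: filterS3 nA ng Uy => z ? ? ?; split.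
move=> /near_normP[r r0 rP].
exists d, (r / (2 * (`|d| + 1))); split.
- by rewrite divr_gt0// mulr_gt0// ltr_wpDl.
- apply: (derive_decreasing_near _ _ _ _ _ r0) => x /rP[Ax gx _].
  by have [dg _] := gd _ Ax; split; [exact: Ax|exact: dg|exact: gx].
- apply: filterS FV => l Vl.
  apply: (derive_decreasing_near _ _ _ _ _ r0) => x /rP[Ax _ Ux].
  have [dg _] := gd _ Ax; have [dh _] := hd _ Ax.
  have dlh : derivable (l *: h) x d by apply: derivableZ; exact: dh.
  split; [exact: Ax|exact: (derivableD dg dlh)|].
  rewrite (derive_add_scale _ _ _ _ _ dg dh).
  exact: (UVP (x, l) (conj Ux Vl) Ax).
Qed.

End descent.

(** * Regular sublevel sets *)

Section regular_sublevel.
Context {R : realType}.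
Variables (D : set (R * R)) (u : R * R -> R).
Hypothesis oD : open D.
Hypothesis cu : {within closure D, continuous u}.
Hypothesis uD : C2_on D u.
Hypothesis ubd : forall x, bd D x -> 0 < u x.
Hypothesis ureg : forall x, D x -> u x = 0 -> 0 < enorm (grad u x).

Lemma sublevel_open : open (sublevel D u).
Proof.
rewrite openE => x [Dx ux].
have cx : {for x, continuous u} by exact: (within_closure_continuous D).
have nD : \forall z \near x, D z by exact: open_nbhs_nbhs.
have nu : \forall z \near x, u z < 0 by move/cvgr_lt/(_ _ ux) : cx.
by apply: filterS2 nD nu => z ? ?.
Qed.

(** At a zero of u inside D, u takes negative values arbitrarily close along the
    descent direction; on bd D, u is positive. *)
Lemma bd_sublevel : bd (sublevel D u) = zeroset D u.
Proof.
have oS := sublevel_open.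
have [uC1 _ _] := uD.
apply/seteqP; split=> x.
  move=> xbd; have [clx nx] := xbd.
  have clDx : closure D x by apply: closureS clx => z [].
  have ux0 : u x <= 0.
    rewrite leNgt; apply/negP => ux.
    move/subspace_continuousP : (cu) => /(_ _ clDx)/cvgr_gt/(_ _ ux) nu.
    have [z [[Dz uz] /(_ (subset_closure Dz))]] := clx _ nu.
    by rewrite ltNge (ltW uz).
  have Dx : D x.
    have := clDx; rewrite closure_setU_bd => -[//|/ubd].
    by rewrite ltNge ux0.
  split => //; apply/eqP; rewrite eq_le ux0 leNgt; apply/negP => ux.
  exact: (open_not_bd _ _ oS _ xbd).
move=> [Dx ux]; split; last by move=> /interior_subset[_]; rewrite ux ltxx.
have [d [r [r0 dec _]]] := regular_decreasing D u u x oD uC1 uC1 Dx (ureg _ Dx ux).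
move=> B /near_normP[e e0 eB].
have d1 : 0 < `|d| + 1 by rewrite ltr_wpDl.
(* s d is shorter than e, so that x + s d is in the neighbourhood B of x. *)
pose s := Num.min (r / 2) (e / 2 / (`|d| + 1)).
have s0 : 0 < s by rewrite lt_min !divr_gt0.
have sr : s < r by rewrite gt_min; apply/orP; left; move: r0; lra.
have se : s <= e / 2 / (`|d| + 1) by rewrite ge_min lexx orbT.
have xx : `|x - x| < r by rewrite subrr normr0.
have zr : `|0 : R| < r by rewrite normr0.
have {}sr : `|s| < r by rewrite gtr0_norm.
have [_ /(_ s sr s0)] := dec _ xx 0 zr; rewrite scale0r addr0 ux => us.
have [Ds _] := dec _ xx s sr.
exists (x + s *: d); split => //; apply: eB.
rewrite addrAC subrr add0r normrZ gtr0_norm//.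
move: se; rewrite ler_pdivlMr// mulrDr mulr1 => se.
by move: se s0 e0; lra.
Qed.

Lemma sublevel_C2_set : C2_set (sublevel D u).
Proof.
split; first exact: sublevel_open.
rewrite bd_sublevel => x [Dx ux].
have [r [n [gam [r0 n1 gC2 gP]]]] := sublevel_graph _ _ _ oD uD Dx ux (ureg _ Dx ux).
exists r, n, gam; split => // y yr; have [Dy <-] := gP _ yr.
by split=> [[]|].
Qed.

End regular_sublevel.

(** The points of A which satisfy P form a subset that is open and closed in A. *)
Lemma open_connected_ind {R : realType} (A P : set (R * R)) (x : R * R) :
    open A -> connected A -> A x -> P x ->
    (forall y, A y -> \forall z \near y, P y <-> P z) ->
  A `<=` P.
Proof.
move=> oA cA Ax Px loc.
have nA y : A y -> \forall z \near y, A z by move=> ?; exact: open_nbhs_nbhs.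
have <- : A `&` P = A; last by move=> z [].
apply: cA; first by exists x.
- exists (A `&` P); last by rewrite setIA setIid.
  rewrite openE => y [Ay Py]; apply: filterS2 (nA _ Ay) (loc _ Ay) => z Az PE.
  by split => //; apply/PE.
- exists (~` (A `&` ~` P)).
    apply: open_closedC; rewrite openE => y [Ay Py].
    apply: filterS2 (nA _ Ay) (loc _ Ay) => z Az PE.
    by split => // /PE.
  by rewrite setCI setCK setIUr setICr set0U.
Qed.

(** * Small perturbations of a regular sublevel set *)

Section perturbation.
Context {R : realType}.
Variables (D : set (R * R)) (g h : R * R -> R).
Hypothesis oD : open D.
Hypothesis compD : compact (closure D).
Hypothesis cg : {within closure D, continuous g}.
Hypothesis ch : {within closure D, continuous h}.
Hypothesis gD : C2_on D g.
Hypothesis hD : C2_on D h.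
Hypothesis gbd : forall x, bd D x -> 0 < g x.
Hypothesis greg : forall x, D x -> g x = 0 -> 0 < enorm (grad g x).

Local Notation G l := (g + l *: h).
Local Notation S l := (sublevel D (G l)).

Lemma near_G_lt y c : closure D y -> g y < c ->
  \forall x \near y & l \near 0^'+, closure D x -> G l x < c.
Proof.
move=> Dy gy; apply: (near_add_scale_lt (closure D) g h) => //.
  by move/subspace_continuousP : cg; exact.
by move/subspace_continuousP : ch; exact.
Qed.

Lemma near_G_gt y c : closure D y -> c < g y ->
  \forall x \near y & l \near 0^'+, closure D x -> c < G l x.
Proof.
move=> Dy gy; apply: (near_add_scale_gt (closure D) g h) => //.
  by move/subspace_continuousP : cg; exact.
by move/subspace_continuousP : ch; exact.
Qed.

(** Compactness of closure D turns smallness of l near each point into uniform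
    smallness of l. *)
Lemma near_closure (P : R -> R * R -> Prop) :
    (forall y, closure D y -> \forall x \near y & l \near 0^'+, P l x) ->
  \forall l \near 0^'+, forall x, closure D x -> P l x.
Proof.
move: compD => /compact_near_coveringP H HP.
exact: (H _ (0 : R)^'+ P).
Qed.

Lemma near_true (P : R -> R * R -> Prop) (y : R * R) : (\forall x \near y, forall l, P l x) ->
  \forall x \near y & l \near (0 : R)^'+, P l x.
Proof.
move=> yP; exists ([set x | forall l, P l x], setT); first by split => //; exact: filterT.
by move=> [x l] [/= H _]; exact: H.
Qed.

Lemma near2S (P Q : R * R -> R -> Prop) (y : R * R) : (forall x l, P x l -> Q x l) ->
  (\forall x \near y & l \near (0 : R)^'+, P x l) ->
  \forall x \near y & l \near (0 : R)^'+, Q x l.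
Proof. by move=> PQ; apply: filterS => -[x l]; exact: PQ. Qed.

Lemma perturb_bd : \forall l \near 0^'+, forall x, bd D x -> 0 < G l x.
Proof.
have : \forall l \near 0^'+, forall x, closure D x -> bd D x -> 0 < G l x.
  apply: near_closure => y; rewrite closure_setU_bd => -[Dy|by_].
    apply: near_true; have : \forall z \near y, D z by exact: open_nbhs_nbhs.
    by apply: filterS => z Dz l /(open_not_bd _ _ oD Dz).
  have [cy _] := by_; apply: near2S (near_G_gt _ _ cy (gbd _ by_)) => x l H bx.
  by apply: H; case: bx.
by apply: filterS => l H x bx; apply: H => //; case: bx.
Qed.

Lemma perturb_neg (E : set (R * R)) : closure E `<=` D ->
  (forall x, closure E x -> g x < 0) ->
  \forall l \near 0^'+, forall x, closure E x -> G l x < 0.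
Proof.
move=> ED gE.
have clD x : closure E x -> closure D x by move=> /ED/subset_closure.
have : \forall l \near 0^'+, forall x, closure D x -> closure E x -> G l x < 0.
  apply: near_closure => y cy; have [Ey|nEy] := pselect (closure E y).
    apply: near2S (near_G_lt _ _ cy (gE _ Ey)) => x l H Ex.
    by apply: H; exact: clD.
  apply: near_true; have : \forall z \near y, (~` closure E) z.
    by apply: open_nbhs_nbhs; split => //; apply: closed_openC; exact: closed_closure.
  by apply: filterS => z ? l.
by apply: filterS => l H x Ex; apply: H => //; exact: clD.
Qed.

Lemma closure_cases y : closure D y ->
  [\/ 0 < g y, D y /\ g y < 0 | D y /\ g y = 0].
Proof.
rewrite closure_setU_bd => -[Dy|/gbd]; last by constructor 1.
by case: (ltgtP (g y) 0) => [H|H|H]; [constructor 2|constructor 1|constructor 3].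
Qed.

Lemma near_G_neq0 y : closure D y -> g y <> 0 ->
  \forall x \near y & l \near 0^'+, closure D x -> G l x <> 0.
Proof.
move=> cy gy; case: (ltgtP (g y) 0) => [H|H|//].
  by apply: near2S (near_G_lt _ _ cy H) => x l H1 /H1 + E; rewrite E ltxx.
by apply: near2S (near_G_gt _ _ cy H) => x l H1 /H1 + E; rewrite E ltxx.
Qed.

Lemma near_derive_neq0 (e : R * R) y : C1_along e D g -> C1_along e D h ->
  D y -> 'D_e g y != 0 ->
  \forall x \near y & l \near 0^'+, D x -> 'D_e (G l) x != 0.
Proof.
move=> ge he Dy; have [_ c1] := ge _ Dy; have [_ c2] := he _ Dy.
have DE x l : D x -> 'D_e (G l) x = 'D_e g x + l * 'D_e h x.
  by move=> Dx; apply: derive_add_scale; [have [] := ge _ Dx|have [] := he _ Dx].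
rewrite neq_lt => /orP[n0|p0].
  apply: near2S (near_add_scale_lt D _ _ _ _ (continuous_within _ _ _ c1)
    (continuous_within _ _ _ c2) n0) => x l H Dx.
  by rewrite DE// lt_eqF// H.
apply: near2S (near_add_scale_gt D _ _ _ _ (continuous_within _ _ _ c1)
  (continuous_within _ _ _ c2) p0) => x l H Dx.
by rewrite DE// gt_eqF// H.
Qed.

Lemma perturb_regular :
  \forall l \near 0^'+, forall x, D x -> G l x = 0 -> 0 < enorm (grad (G l) x).
Proof.
have [[g1 g2] _ _] := gD; have [[h1 h2] _ _] := hD.
have enP (v : R * R) : v.1 != 0 \/ v.2 != 0 -> 0 < enorm v.
  rewrite enorm_gt0 => -[v0|v0].
    by rewrite ltr_wpDr ?sqr_ge0// lt_def sqr_ge0 sqrf_eq0 v0.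
  by rewrite ltr_wpDl ?sqr_ge0// lt_def sqr_ge0 sqrf_eq0 v0.
have : \forall l \near 0^'+, forall x, closure D x ->
    D x -> G l x = 0 -> 0 < enorm (grad (G l) x).
  apply: near_closure => y cy; have [gy|gy] := pselect (g y = 0); last first.
    by apply: near2S (near_G_neq0 _ cy gy) => x l H Dx /(H (subset_closure Dx)).
  have Dy : D y by case: (closure_cases _ cy) => [|[]//|[]//]; rewrite gy ltxx.
  have := greg _ Dy gy; rewrite enorm_gt0 /= => gr.
  have [e1z|e1n] := eqVneq ('D_e1 g y) 0.
    have e2n : 'D_e2 g y != 0.
      by apply: contraTneq gr => ->; rewrite e1z expr0n/= addr0 ltxx.
    apply: near2S (near_derive_neq0 _ _ g2 h2 Dy e2n) => x l H /H e2n' _.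
    by apply: enP; right.
  apply: near2S (near_derive_neq0 _ _ g1 h1 Dy e1n) => x l H /H e1n' _.
  by apply: enP; left.
by apply: filterS => l H x Dx; apply: H => //; exact: subset_closure.
Qed.

Lemma enorm_lt_half x y (r : R) : `|x - y| < r / 2 -> enorm (x - y) <= r.
Proof. by move=> xy; have := enorm_le_norm (x - y); move: xy; lra. Qed.

Lemma perturbed_zero_near_zero (r : R) : 0 < r -> \forall l \near 0^'+,
  forall y, zeroset D (G l) y -> exists2 x, zeroset D g x & enorm (x - y) <= r.
Proof.
move=> r0.
have : \forall l \near 0^'+, forall y, closure D y -> zeroset D (G l) y ->
    exists2 x, zeroset D g x & enorm (x - y) <= r.
  apply: near_closure => y cy; have [gy|gy] := pselect (g y = 0); last first.
    apply: near2S (near_G_neq0 _ cy gy) => x l H [Dx].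
    by move/(H (subset_closure Dx)).
  have Dy : D y by case: (closure_cases _ cy) => [|[]//|[]//]; rewrite gy ltxx.
  have r20 : 0 < r / 2 by rewrite divr_gt0.
  apply: near_true; apply: filterS (near_norm_lt y _ r20) => x xy l _.
  by exists y => //; apply: enorm_lt_half; rewrite distrC.
by apply: filterS => l H y Zy; apply: H => //; case: Zy => /subset_closure.
Qed.

Lemma G_C1 l : C1_on D (G l).
Proof.
by have [g0 _ _] := gD; have [h0 _ _] := hD; exact: C1_on_add_scale.
Qed.

(** Close to a zero y of g, G_l is positive at y - s d and negative at y + s d,
    for a small fixed s and all small l; in between it has a zero. *)
Lemma zero_near_perturbed_zero (r : R) : 0 < r -> \forall l \near 0^'+,
  forall x, zeroset D g x -> exists2 y, zeroset D (G l) y & enorm (x - y) <= r.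
Proof.
move=> r0.
have : \forall l \near 0^'+, forall x, closure D x -> zeroset D g x ->
    exists2 y, zeroset D (G l) y & enorm (x - y) <= r.
  apply: near_closure => y cy; have [gy|gy] := pselect (g y = 0); last first.
    apply: near_true.
    have : \forall x \near within (closure D) (nbhs y), g x != 0.
      move/subspace_continuousP : (cg) => /(_ _ cy) cgy.
      by apply: (cvgr_neq0 _ cgy); apply/eqP.
    rewrite near_withinE; apply: filterS => x H l [Dx gx].
    by have := H (subset_closure Dx); rewrite gx eqxx.
  have Dy : D y by case: (closure_cases _ cy) => [|[]//|[]//]; rewrite gy ltxx.
  have [g0 _ _] := gD; have [h0 _ _] := hD.
  have [d [q [q0 dec decl]]] := regular_decreasing D g h y oD g0 h0 Dy (greg _ Dy gy).
  have d1 : 0 < `|d| + 1 by rewrite ltr_wpDl.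
  have r40 : 0 < r / 4 by rewrite divr_gt0.
  pose s := Num.min (q / 2) (r / 4 / (`|d| + 1)).
  have s0 : 0 < s by rewrite lt_min !divr_gt0.
  have sq : s < q by rewrite gt_min; apply/orP; left; move: q0; lra.
  have sd : s * `|d| < r / 4.
    have : s <= r / 4 / (`|d| + 1) by rewrite ge_min lexx orbT.
    by rewrite ler_pdivlMr// mulrDr mulr1; move: s0; lra.
  have I t : - s <= t <= s -> `|t| < q.
    by rewrite -ler_norml => /le_lt_trans; apply.
  have yy : `|y - y| < q by rewrite subrr normr0.
  have sI : `|s| < q by rewrite gtr0_norm.
  have nsI : `|- s| < q by rewrite normrN gtr0_norm.
  have zI : `|0 : R| < q by rewrite normr0.
  have [Dp _] := dec _ yy _ sI; have [Dn /(_ _ zI)] := dec _ yy _ nsI.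
  rewrite scale0r addr0 gy oppr_lt0 => /(_ s0) gn.
  have gp : g (y + s *: d) < 0.
    by have [_ /(_ _ sI s0)] := dec _ yy _ zI; rewrite scale0r addr0 gy.
  have np : \forall l \near 0^'+, closure D (y + s *: d) -> G l (y + s *: d) < 0.
    apply: (near2_point _ _ (fun x l => closure D x -> G l x < 0)).
    exact: near_G_lt (subset_closure Dp) gp.
  have nn : \forall l \near 0^'+, closure D (y + - s *: d) -> 0 < G l (y + - s *: d).
    apply: (near2_point _ _ (fun x l => closure D x -> 0 < G l x)).
    exact: near_G_gt (subset_closure Dn) gn.
  have ex : \forall l \near 0^'+, exists2 z, zeroset D (G l) z & `|y - z| < r / 4.
    apply: filterS2 np nn => l /(_ (subset_closure Dp)) Gp /(_ (subset_closure Dn)) Gn.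
    have le : - s <= s by move: s0; lra.
    have ct : {within `[- s, s], continuous (fun t => G l (y + t *: d))}.
      apply: continuous_in_subspaceT => t; rewrite inE/= in_itv/= => /I tq.
      have [Dt _] := dec _ yy _ tq.
      have := is_derive_line (G l) y d t (C1_derivable _ _ _ _ oD (G_C1 l) Dt).
      exact: is_derive_continuous.
    have [|t tI Gt] := @IVT _ _ _ _ 0 le ct.
      by rewrite ge_min le_max (ltW Gp) (ltW Gn) orbT.
    move: tI; rewrite in_itv/= => tI; have [Dt _] := dec _ yy _ (I _ tI).
    exists (y + t *: d) => //; rewrite opprD addrA subrr add0r normrN normrZ.
    by move: tI; rewrite -ler_norml => /(ler_wpM2r (normr_ge0 d))/le_lt_trans; apply.
  exists ([set x | `|x - y| < r / 4],
    [set l | exists2 z, zeroset D (G l) z & `|y - z| < r / 4]).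
    by split => //=; exact: near_norm_lt.
  move=> [x l] [/= xy [z Zz yz]] _; exists z => //; apply: enorm_lt_half.
  have -> : x - z = (x - y) + (y - z) by rewrite addrA subrK.
  by rewrite (le_lt_trans (ler_normD _ _))//; move: xy yz; lra.
by apply: filterS => l H x Zx; apply: H => //; case: Zx => /subset_closure.
Qed.

(** On a ball around y, g is bounded away from 0, so that the ball is contained
    in S_l for small l. *)
Lemma near_component y : D y -> g y < 0 -> exists2 r : R, 0 < r &
  \forall l \near 0^'+, forall x x', `|x - y| < r -> `|x' - y| < r ->
    connected_component (S l) x x'.
Proof.
move=> Dy gy.
have [[U V] /= [Uy FV] UVP] := near_G_lt _ _ (subset_closure Dy) gy.
have nD : \forall z \near y, D z by exact: open_nbhs_nbhs.
have : \forall z \near y, D z /\ U z by apply: filterS2 nD Uy => z ? ?; split.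
move=> /near_normP[r r0 rP]; exists r => //.
apply: filterS FV => l Vl x x'; apply: ball_component => z /rP[Dz Uz].
by split => //; apply: (UVP (z, l)) => //=; exact: subset_closure.
Qed.

(** By [near_component], being joined to x0 in S_l for all small l is a property
    that passes from a point of S_0 to all nearby points and back; here l need
    not be small uniformly in y. *)
Lemma perturb_component x0 : connected (sublevel D g) -> sublevel D g x0 ->
  forall y, sublevel D g y -> \forall l \near 0^'+, connected_component (S l) x0 y.
Proof.
move=> cS Sx0 y Sy.
have oS : open (sublevel D g) by exact: sublevel_open.
apply: (open_connected_ind _ (fun y => \forall l \near 0^'+,
  connected_component (S l) x0 y) x0 oS cS) Sy => //.
  have [r r0] := near_component _ Sx0.1 Sx0.2; apply: filterS => l; apply.
    by rewrite subrr normr0.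
  by rewrite subrr normr0.
move=> z [Dz gz]; have [r r0 rP] := near_component _ Dz gz.
apply: filterS (near_norm_lt z _ r0) => w wz.
have zz : `|z - z| < r by rewrite subrr normr0.
split=> H; apply: filterS2 H rP => l H1 H2.
  by apply: connected_component_trans H1 _; exact: H2.
by apply: connected_component_trans H1 _; exact: H2.
Qed.

(** Every point of S_l is joined to x0 within S_l, for l small uniformly in the
    point.  Near a zero y of g, the point is first moved along the descent
    direction to the neighbourhood of a point z of S_0. *)
Lemma perturb_connected : sublevel D g !=set0 -> connected (sublevel D g) ->
  \forall l \near 0^'+, connected (S l).
Proof.
move=> [x0 Sx0] cS.
have : \forall l \near 0^'+, forall y, closure D y -> S l y ->
    connected_component (S l) x0 y.
  apply: near_closure => y cy; have [gy|[Dy gy]|[Dy gy]] := closure_cases _ cy.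
  - apply: near2S (near_G_gt _ _ cy gy) => x l H [/subset_closure Dx].
    by rewrite ltNge (ltW (H Dx)).
  - have [r r0 rP] := near_component _ Dy gy.
    have yP := perturb_component x0 cS Sx0 y (conj Dy gy).
    exists ([set x | `|x - y| < r], [set l | connected_component (S l) x0 y /\
      forall x x', `|x - y| < r -> `|x' - y| < r ->
        connected_component (S l) x x']).
      by split => /=; [exact: near_norm_lt|apply: filterS2 yP rP => l ? ?; split].
    move=> [x l] [/= xy [H1 H2]] _; apply: connected_component_trans H1 _.
    by apply: H2 => //; rewrite subrr normr0.
  - have [g0 _ _] := gD; have [h0 _ _] := hD.
    have [d [r [r0 dec decl]]] := regular_decreasing D g h y oD g0 h0 Dy (greg _ Dy gy).
    have s0 : 0 < r / 2 by rewrite divr_gt0.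
    have sr : `|r / 2| < r by rewrite gtr0_norm//; move: r0; lra.
    have yy : `|y - y| < r by rewrite subrr normr0.
    have z0 : `|0 : R| < r by rewrite normr0.
    pose z := y + (r / 2) *: d.
    have [Dz _] := dec _ yy _ sr.
    have gz : g z < 0.
      by have [_ /(_ _ sr s0)] := dec _ yy _ z0; rewrite scale0r addr0 gy.
    have [q q0 qP] := near_component z Dz gz.
    have zP := perturb_component x0 cS Sx0 z (conj Dz gz).
    exists ([set x | `|x - y| < r /\ `|x - y| < q],
      [set l | [/\ connected_component (S l) x0 z, decreasing_near (G l) D y d r &
        forall x x', `|x - z| < q -> `|x' - z| < q ->
        connected_component (S l) x x']]).
      split => /=.
        by apply: filterS2 (near_norm_lt y _ r0) (near_norm_lt y _ q0) => x ? ?.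
      by apply: filterS3 zP decl qP => l ? ? ?; split.
    move=> [x l] [/= [xr xq] [H1 H2 H3]] [Dx Gx].
    apply: (connected_component_trans H1).
    apply: (@connected_component_trans _ _ (x + (r / 2) *: d)).
      apply: H3; first by rewrite subrr normr0.
      by rewrite /z opprD addrACA subrr addr0.
    apply: connected_component_sym; apply: segment_component; first exact: ltW.
    move=> t /andP[t0 t1].
    have tr : `|t| < r by rewrite ger0_norm//; move: r0 t1; lra.
    split; first by have [] := H2 _ xr _ tr.
    move: t0; rewrite le_eqVlt => /predU1P[<-|t0]; first by rewrite scale0r addr0.
    have [_ /(_ _ tr t0)] := H2 _ xr _ z0.
    by rewrite scale0r addr0 => /lt_trans; apply.
apply: filterS => l H.
have -> : S l = connected_component (S l) x0.
  apply/seteqP; split; last exact: connected_component_sub.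
  by move=> y Sy; apply: H => //; case: Sy => /subset_closure.
exact: component_connected.
Qed.

End perturbation.

(** On bd D and on the closure of E the function g has a strict sign, so the
    same holds for G_l: S_l stays away from bd D and contains E. *)
Lemma perturb_shapes (R : realType) (D E : set (R * R)) (g h : R * R -> R) (r : R) :
    open D -> bounded_set D -> E !=set0 -> compactly_contained E D ->
    levelsetsE D E g -> connected (sublevel D g) -> C2_closure D h -> 0 < r ->
  \forall l \near 0^'+, shapesE D E (sublevel D (g + l *: h)) /\
    hausdorff_dist (bd (sublevel D g)) (bd (sublevel D (g + l *: h))) <= r.
Proof.
move=> oD bD [x0 Ex0] [cE ED] [[[cg gD] gr gbd _] gE] cS [ch hD] r0.
have compD : compact (closure D) := bounded_compact_closure _ bD.
have {}gD := Ck_ext_C2_on _ _ oD gD; have {}hD := Ck_ext_C2_on _ _ oD hD.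
have greg x : D x -> g x = 0 -> 0 < enorm (grad g x).
  by move=> /gr + gx; rewrite gx normr0 addr0.
(* The base point of S_0 may be any point of E. *)
have Sg0 : sublevel D g x0.
  by split; [exact: ED (subset_closure Ex0)|exact: gE (subset_closure Ex0)].
have nbd := perturb_bd D g h oD compD cg ch gbd.
have nE := perturb_neg D g h compD cg ch E ED gE.
have nreg := perturb_regular D g h compD cg ch gD hD gbd greg.
have nz1 := perturbed_zero_near_zero D g h compD cg ch gbd r r0.
have nz2 := zero_near_perturbed_zero D g h oD compD cg ch gD hD gbd greg r r0.
have nC := perturb_connected D g h oD compD cg ch gD hD gbd greg
  (ex_intro _ x0 Sg0) cS.
apply: filterS3 (filterI nbd nE) (filterI nreg nC) (filterI nz1 nz2).
move=> l [lbd lE] [lreg lC] [lz1 lz2].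
have cl : {within closure D, continuous (g + l *: h)}.
  move=> x; apply: cvgD; first exact: cg.
  by apply: cvgM; [exact: cvg_cst|exact: ch].
have lD : C2_on D (g + l *: h) := C2_on_add_scale _ _ _ _ oD gD hD.
have lbdE := bd_sublevel _ _ oD cl lD lbd lreg.
have gbdE := bd_sublevel _ _ oD cg gD gbd greg.
split; last by rewrite lbdE gbdE; apply: hausdorff_dist_le => //; exact: ltW.
have lES : closure E `<=` sublevel D (g + l *: h).
  by move=> x Ex; split; [exact: ED|exact: lE].
split; last by split.
split; first by move=> x [].
- split; [by exists x0; exact: lES (subset_closure Ex0)| |exact: lC].
  exact: sublevel_open _ _ oD cl.
- exact: sublevel_C2_set _ _ oD cl lD lbd lreg.
- rewrite lbdE -subset0 => x [[Dx _] bx].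
  exact: open_not_bd _ _ oD Dx bx.
Qed.

(** * Local optimality *)

Theorem theorem5p1 (R : realType) (D E : set (R * R)) (p : R)
    (f : R * R -> R) (beta : R -> R)
    (J : set (R * R) -> (R * R -> R) -> R) (Oms : set (R * R))
    (hD : domain D) (hDb : bounded_set D)
    (hE : domain E) (hED : compactly_contained E D)
    (hp : 2 < p) (hf : memLp D p f)
    (hbeta : admissible_nonlinearity beta)
    (hJ : respects_ae D J)
    (hOpt : locally_optimal D E beta f J Oms) :
  forall gs : R * R -> R, levelsetsE D E gs -> sublevel D gs = Oms ->
  forall h : R * R -> R, levelsets D h ->
    (forall C, components (zeroset D gs) C -> zeroset D h `&` C !=set0) ->
    dir_differentiable (reduced D beta f J) gs h ->
    0 <= dir_deriv (reduced D beta f J) gs h.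
Proof.
move=> gs gsF gsO h [hC2 _ _ _] _ jd.
have [[_ oD _] [E0 _ _]] := (hD, hE).
have [[[_ [_ _ cO] _ _] _] [r r0 opt]] := hOpt.
have cgs : connected (sublevel D gs) by rewrite gsO.
apply: limr_ge jd _.
have l0 : \forall l \near (0 : R)^'+, 0 < l by exact: nbhs_right_gt.
apply: filterS2 l0 (perturb_shapes _ _ _ _ _ _ oD hDb E0 hED gsF cgs hC2 r0).
move=> l l0 [lS ld]; rewrite /diffquot divr_ge0 ?(ltW l0)// subr_ge0 /reduced gsO.
by apply: opt => //; rewrite -gsO.
Qed.
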